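(* Let $\mathcal{H}$ be a separable infinite-dimensional complex Hilbert space, $T$ a bounded linear operator on $\mathcal{H}$, and $n,k$ positive integers. Then $T$ is a completely non-unitary contraction such that $\mathcal{D}_T\subseteq\mathcal{D}_{T^*}$, $\dim\mathcal{D}_T=n$, $\dim\mathcal{D}_{T^*}<\infty$ and $\dim(\mathcal{D}_{T^*}\ominus\mathcal{D}_T)=k$ if and only if there exists an orthonormal basis $\{e_m\}_{m\geq1}$ of $\mathcal{H}$ with respect to which $T=S_k+F$, where $S_k e_m=e_{m+k}$ ($m\ge 1$) is the unilateral shift of multiplicity $k$ and $F$ is a finite rank operator such that, writing $P_j$ for the orthogonal projection onto $\mathrm{span}\{e_1,\dots,e_j\}$, $F_1=F+S_kP_n$ and $F_r=F_1^r+\sum_{j=1}^{r-1}S_k^{j}(I-P_n)F_1^{r-j}$ for $r\ge2$, the following hold: (1) $\mathrm{rank}(P_n-F_1^*F_1)=n$; (2) $F_1(I-P_n)=(I-P_{n+k})F_1=0$; (3) there exists $\lambda\geq 0$ such that $\lambda\|F_1^*x\|^2-\|F_1x\|^2\leq \lambda \|P_{n+k} x\|^2-\|P_n x\|^2$ for all $x\in \mathcal{H}$; (4) for all $r\geq 1$ and $x\in\mathcal{H}$, $\|F_rx\|\leq \|P_n x\|$ and $\|F_r^*x\|\leq \|P_{n+kr}x\|$, and the only $x$ satisfying $\|F_rx\|=\|P_nx\|$ and $\|F_r^*x\|=\|P_{n+kr}x\|$ for all $r\geq1$ is $x=0$.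
   Context: For a contraction $T$ on a Hilbert space $\mathcal{H}$, $D_T=(I-T^*T)^{1/2}$, $D_{T^*}=(I-TT^* )^{1/2}$, $\mathcal{D}_T=\overline{D_T\mathcal{H}}$, $\mathcal{D}_{T^*}=\overline{D_{T^*}\mathcal{H}}$. A contraction is completely non-unitary if it has no nonzero reducing subspace on which it is unitary. *)

(* Defs.v *)
From HB Require Import structures.
From mathcomp Require Import all_boot all_order all_algebra.
From mathcomp Require Import reals.
From mathcomp Require Import complex.
From Stdlib Require Import ClassicalEpsilon.

Set Implicit Arguments.
Unset Strict Implicit.
Unset Printing Implicit Defensive.

Import Order.TTheory GRing.Theory Num.Theory.
Local Open Scope ring_scope.

Section Hilbert.
Variables (R : realType) (V : lmodType R[i]) (ip : V -> V -> R[i]).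

Definition hnorm (x : V) : R := Num.sqrt (@complex.Re R (ip x x)).

Definition inner_product : Prop :=
  [/\ forall (a : R[i]) (x y z : V), ip (a *: x + y) z = a * ip x z + ip y z,
      forall x y, ip y x = conjc (ip x y),
      forall x, 0 <= ip x x
    & forall x, ip x x = 0 -> x = 0].

Definition cvg_to (u : nat -> V) (l : V) : Prop :=
  forall eps : R, 0 < eps -> exists N, forall m, (N <= m)%N -> hnorm (u m - l) < eps.

Definition cauchy_seq (u : nat -> V) : Prop :=
  forall eps : R, 0 < eps -> exists N, forall m p, (N <= m)%N -> (N <= p)%N ->
    hnorm (u m - u p) < eps.

Definition complete : Prop :=
  forall u, cauchy_seq u -> exists l, cvg_to u l.

Definition in_closure (S : V -> Prop) (x : V) : Prop :=
  forall eps : R, 0 < eps -> exists y, S y /\ hnorm (x - y) < eps.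

Definition separable : Prop :=
  exists u : nat -> V, forall x, in_closure (fun y => exists m, y = u m) x.

Definition orthonormal (I : eqType) (b : I -> V) : Prop :=
  forall i j, ip (b i) (b j) = (if i == j then 1 else 0).

Definition infinite_dim : Prop :=
  forall N, exists b : 'I_N -> V, orthonormal b.

Definition sep_inf_hilbert : Prop :=
  [/\ inner_product, complete, separable & infinite_dim].

Definition span_fin (N : nat) (b : 'I_N -> V) (x : V) : Prop :=
  exists c : 'I_N -> R[i], x = \sum_(i < N) c i *: b i.

Definition span_seq (e : nat -> V) (x : V) : Prop :=
  exists N (c : 'I_N -> R[i]), x = \sum_(i < N) c i *: e i.

Definition has_dim (M : V -> Prop) (N : nat) : Prop :=
  exists b : 'I_N -> V, orthonormal b /\ forall x, M x <-> span_fin b x.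

Definition range (A : V -> V) (y : V) : Prop := exists x, y = A x.

Definition linear_op (A : V -> V) : Prop :=
  forall (a : R[i]) x y, A (a *: x + y) = a *: A x + A y.

Definition bounded_op (A : V -> V) : Prop :=
  linear_op A /\ exists M : R, forall x, hnorm (A x) <= M * hnorm x.

Definition is_adjoint (A B : V -> V) : Prop :=
  forall x y, ip (A x) y = ip x (B y).

(* the Hilbert-space adjoint A^* (unique for bounded A) *)
Definition adj (A : V -> V) : V -> V :=
  epsilon (inhabits (fun x : V => x)) (is_adjoint A).

Definition contraction (A : V -> V) : Prop := forall x, hnorm (A x) <= hnorm x.

Definition is_pos_sqrt (A B : V -> V) : Prop :=
  [/\ bounded_op B, forall x, 0 <= ip (B x) x & forall x, B (B x) = A x].

Definition op_sqrt (A : V -> V) : V -> V :=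
  epsilon (inhabits (fun x : V => x)) (is_pos_sqrt A).

Definition defect_op (T : V -> V) : V -> V :=
  op_sqrt (fun x => x - adj T (T x)).

Definition defect_space (T : V -> V) : V -> Prop :=
  in_closure (range (defect_op T)).

Definition closed_subspace (M : V -> Prop) : Prop :=
  [/\ M 0, forall (a : R[i]) x y, M x -> M y -> M (a *: x + y)
    & forall x, in_closure M x -> M x].

Definition reducing (T : V -> V) (M : V -> Prop) : Prop :=
  [/\ closed_subspace M, forall x, M x -> M (T x) & forall x, M x -> M (adj T x)].

Definition unitary_on (T : V -> V) (M : V -> Prop) : Prop :=
  (forall x, M x -> hnorm (T x) = hnorm x) /\
  (forall y, M y -> exists x, M x /\ T x = y).

Definition completely_non_unitary (T : V -> V) : Prop :=
  forall M, reducing T M -> unitary_on T M -> forall x, M x -> x = 0.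

Definition ominus (M N : V -> Prop) (x : V) : Prop :=
  M x /\ forall y, N y -> ip x y = 0.

Definition onb (e : nat -> V) : Prop :=
  orthonormal e /\ forall x, in_closure (span_seq e) x.

(* P_j : orthogonal projection onto span {e_1, ..., e_j}
   (e 0 plays the role of e_1) *)
Definition proj (e : nat -> V) (j : nat) (x : V) : V :=
  \sum_(i < j) ip x (e i) *: e i.

Definition finite_rank (A : V -> V) : Prop :=
  exists N (b : 'I_N -> V), forall x, span_fin b (A x).

Definition F1op (S F : V -> V) (e : nat -> V) (n : nat) (x : V) : V :=
  F x + S (proj e n x).

(* F_r = F_1^r + sum_{j=1}^{r-1} S^j (I - P_n) F_1^{r-j}  (equals F_1 for r = 1) *)
Definition Frop (S F : V -> V) (e : nat -> V) (n r : nat) (x : V) : V :=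
  iter r (F1op S F e n) x +
  \sum_(1 <= j < r)
     iter j S (iter (r - j) (F1op S F e n) x - proj e n (iter (r - j) (F1op S F e n) x)).

End Hilbert.

(* Main.v *)
(** Write [T'] for the adjoint of [T].  The defect space of [T] is the orthogonal
    complement of [K := ker (1 - T'T)], that of [T'] the complement of
    [L := ker (1 - TT')].  A contraction [T] maps [K] isometrically onto [L], and the
    inclusion of defect spaces says that [L] is contained in [K]; so [T] restricts to
    an isometry of [K] whose wandering space, the complement of [L] in [K], has
    dimension [k].  Its unitary part reduces [T], hence vanishes when [T] is completely
    non-unitary.  Thus a basis of the defect space of [T], followed by the images under
    the powers of [T] of a basis of the wandering space, is an orthonormal basis [e]
    with [T e_m = e_(m+k)] for [m > n].

    For such a basis [F_1 = T P_n], [F_r = T^r P_n], and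
      [|T^r x|^2 = |F_r x|^2 + |x|^2 - |P_n x|^2],
      [|T'^r x|^2 = |F_r' x|^2 + |x|^2 - |P_(n+kr) x|^2],
      [1 - T'T = P_n - F_1'F_1], [1 - TT' = P_(n+k) - F_1F_1'].
    So (4) says that [T] is a contraction with no nonzero vector on which all powers
    of [T] and [T'] are isometric, i.e. that [T] is completely non-unitary; (1) gives
    the dimension of the defect space of [T]; and (3) holds because [1 - TT'] is
    positive and invertible on the range of [P_(n+k)]. *)

Require Import Defs.
From HB Require Import structures.
From mathcomp Require Import all_boot all_order all_algebra.
From mathcomp Require Import reals.
From mathcomp Require Import complex.
From mathcomp Require Import ring lra.
From mathcomp Require boolp classical_sets.
Import Order.TTheory GRing.Theory Num.Theory.
Local Open Scope ring_scope.

Set Implicit Arguments.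
Unset Strict Implicit.
Unset Printing Implicit Defensive.

(** * Inner product spaces *)

Section ComplexNumbers.
Variable R : realType.
Implicit Types z w : R[i].

Lemma ReD z w : complex.Re (z + w) = complex.Re z + complex.Re w.
Proof. by case: z w => [a b] [c d]. Qed.

Lemma ReB z w : complex.Re (z - w) = complex.Re z - complex.Re w.
Proof. by case: z w => [a b] [c d]. Qed.

Lemma Re_conjc z : complex.Re (conjc z) = complex.Re z.
Proof. by case: z. Qed.

Lemma conjcD z w : conjc (z + w) = conjc z + conjc w.
Proof. exact: rmorphD. Qed.

Lemma conjcN z : conjc (- z) = - conjc z.
Proof. exact: rmorphN. Qed.

Lemma conjcM z w : conjc (z * w) = conjc z * conjc w.
Proof. exact: rmorphM. Qed.

Lemma ReZ (t : R) z : complex.Re (t%:C%C * z) = t * complex.Re z.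
Proof. by case: z => a b /=; rewrite mul0r subr0. Qed.

(** Multiplication by [i] moves the imaginary part, up to sign, into the real part. Complex
    identities are derived below from real ones in this way. *)
Lemma eq_complex_Re z w : complex.Re z = complex.Re w ->
  complex.Re ('i%C * z) = complex.Re ('i%C * w) -> z = w.
Proof.
case: z w => [a b] [c d] /= -> ; rewrite !mul0r !mul1r !sub0r => /eqP.
by rewrite eqr_opp => /eqP ->.
Qed.

End ComplexNumbers.

Lemma ler_of_eps (R : realFieldType) (x y : R) : (forall e, 0 < e -> x <= y + e) -> x <= y.
Proof. by move=> h; apply/ler_addgt0Pr. Qed.

Lemma ex_invn_lt (R : realType) (eps : R) : 0 < eps ->
  exists N, forall m, (N <= m)%N -> m.+1%:R^-1 < eps.
Proof.
move=> e0; exists (Num.truncn eps^-1) => m hm.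
rewrite invf_plt ?posrE ?ltr0n //.
apply: lt_le_trans (truncnS_gt _) _.
by rewrite ler_nat.
Qed.

Section HilbertSpace.
Variables (R : realType) (V : lmodType R[i]) (ip : V -> V -> R[i]).
Hypothesis Hip : inner_product ip.
Hypothesis Hc : complete ip.
Implicit Types (x y z : V) (a : R[i]) (A B T : V -> V).

Definition nsq x : R := complex.Re (ip x x).

Lemma ipC x y : ip y x = conjc (ip x y).
Proof. by case: Hip. Qed.

Lemma ipDl x y z : ip (x + y) z = ip x z + ip y z.
Proof. by case: Hip => h _ _ _; rewrite -[x]scale1r h mul1r scale1r. Qed.

Lemma ip0l z : ip 0 z = 0.
Proof. by apply: (addrI (ip 0 z)); rewrite -ipDl !addr0. Qed.

Lemma ipZl a x z : ip (a *: x) z = a * ip x z.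
Proof. by case: Hip => h _ _ _; rewrite -[a *: x]addr0 h ip0l addr0. Qed.

Lemma ipNl x z : ip (- x) z = - ip x z.
Proof. by rewrite -scaleN1r ipZl mulN1r. Qed.

Lemma ipBl x y z : ip (x - y) z = ip x z - ip y z.
Proof. by rewrite ipDl ipNl. Qed.

Lemma ip_suml (I : Type) (r : seq I) (P : pred I) (F : I -> V) z :
  ip (\sum_(i <- r | P i) F i) z = \sum_(i <- r | P i) ip (F i) z.
Proof.
by apply: (big_morph (fun x => ip x z)); [move=> x y; rewrite ipDl | rewrite ip0l].
Qed.

Lemma ipDr x y z : ip z (x + y) = ip z x + ip z y.
Proof. by rewrite ipC ipDl conjcD -!ipC. Qed.

Lemma ip0r z : ip z 0 = 0.
Proof. by rewrite ipC ip0l conjc0. Qed.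

Lemma ipZr a x z : ip z (a *: x) = conjc a * ip z x.
Proof. by rewrite ipC ipZl conjcM -ipC. Qed.

Lemma ipNr x z : ip z (- x) = - ip z x.
Proof. by rewrite ipC ipNl conjcN -ipC. Qed.

Lemma ipBr x y z : ip z (x - y) = ip z x - ip z y.
Proof. by rewrite ipDr ipNr. Qed.

Lemma ip_sumr (I : Type) (r : seq I) (P : pred I) (F : I -> V) z :
  ip z (\sum_(i <- r | P i) F i) = \sum_(i <- r | P i) ip z (F i).
Proof.
by apply: (big_morph (fun x => ip z x)); [move=> x y; rewrite ipDr | rewrite ip0r].
Qed.

Lemma ip_eq0C x y : ip x y = 0 -> ip y x = 0.
Proof. by move=> h; rewrite ipC h conjc0. Qed.

Lemma ip_nsq x : ip x x = (nsq x)%:C%C.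
Proof.
case: Hip => _ _ /(_ x) h _; rewrite /nsq; move: h; rewrite lecE /=.
by case: (ip x x) => a b /= /andP [/eqP -> _].
Qed.

Lemma nsq_ge0 x : 0 <= nsq x.
Proof. by case: Hip => _ _ /(_ x) + _; rewrite lecE => /andP[]. Qed.

Lemma nsq_eq0 x : nsq x = 0 -> x = 0.
Proof. by case: Hip => _ _ _ h h0; apply: h; rewrite ip_nsq h0. Qed.

Lemma nsq0 : nsq 0 = 0.
Proof. by rewrite /nsq ip0l. Qed.

Lemma ip_total x : (forall y, ip x y = 0) -> x = 0.
Proof. by move=> h; apply: nsq_eq0; rewrite /nsq h. Qed.

Lemma ip_inj x y : (forall z, ip x z = ip y z) -> x = y.
Proof.
by move=> h; apply/eqP; rewrite -subr_eq0; apply/eqP/ip_total => z; rewrite ipBl h subrr.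
Qed.

Lemma nsqD x y : nsq (x + y) = nsq x + nsq y + 2 * complex.Re (ip x y).
Proof.
rewrite /nsq ipDl !ipDr !ReD [ip y x]ipC Re_conjc; ring.
Qed.

Lemma nsqN x : nsq (- x) = nsq x.
Proof. by rewrite /nsq ipNl ipNr opprK. Qed.

Lemma nsqB x y : nsq (x - y) = nsq x + nsq y - 2 * complex.Re (ip x y).
Proof. by rewrite nsqD nsqN ipNr -[- ip x y]add0r ReB /=; ring. Qed.

Lemma nsqZ a x : nsq (a *: x) = (complex.Re a ^+ 2 + complex.Im a ^+ 2) * nsq x.
Proof. by rewrite {1}/nsq ipZl ipZr ip_nsq; case: a => u v /=; ring. Qed.

Lemma nsqZR (t : R) x : nsq (t%:C%C *: x) = t ^+ 2 * nsq x.
Proof. by rewrite nsqZ /=; ring. Qed.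

Lemma nsqD_orth x y : ip x y = 0 -> nsq (x + y) = nsq x + nsq y.
Proof. by move=> h; rewrite nsqD h mulr0 addr0. Qed.

Lemma hnorm_sqr x : hnorm ip x ^+ 2 = nsq x.
Proof. by rewrite /hnorm sqr_sqrtr ?nsq_ge0. Qed.

Lemma hnorm_ge0 x : 0 <= hnorm ip x.
Proof. exact: sqrtr_ge0. Qed.

Lemma hnorm_le x y : (hnorm ip x <= hnorm ip y) = (nsq x <= nsq y).
Proof. by rewrite /hnorm ler_sqrt ?nsq_ge0. Qed.

Lemma hnorm_eq x y : hnorm ip x = hnorm ip y <-> nsq x = nsq y.
Proof. by split=> h; [rewrite -!hnorm_sqr h|rewrite /hnorm -/(nsq _) h]. Qed.

Lemma hnorm_eq0 x : hnorm ip x = 0 -> x = 0.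
Proof. by move=> h; apply: nsq_eq0; rewrite -hnorm_sqr h expr0n. Qed.

Lemma hnormN x : hnorm ip (- x) = hnorm ip x.
Proof. by rewrite /hnorm -!/(nsq _) nsqN. Qed.

Lemma hnormB x y : hnorm ip (x - y) = hnorm ip (y - x).
Proof. by rewrite -hnormN opprB. Qed.

Lemma hnorm0 : hnorm ip 0 = 0.
Proof. by rewrite /hnorm ip0l sqrtr0. Qed.

Lemma hnormZR (t : R) x : hnorm ip (t%:C%C *: x) = `|t| * hnorm ip x.
Proof.
by rewrite /hnorm -!/(nsq _) nsqZR sqrtrM ?sqr_ge0 // sqrtr_sqr.
Qed.

(** Expands [|q x - a y|^2 >= 0] with [q = |y|^2] and [a = <x, y>]; the left side equals
    [q (q |x|^2 - |a|^2)], and [q = 0] forces [y = 0]. *)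
Lemma cauchy_schwarz x y :
  complex.Re (ip x y) ^+ 2 + complex.Im (ip x y) ^+ 2 <= nsq x * nsq y.
Proof.
have := nsq_ge0 ((nsq y)%:C%C *: x - (ip x y) *: y).
rewrite nsqB nsqZR nsqZ ipZl ipZr ReZ.
set a := ip x y; have -> : complex.Re (conjc a * a) = complex.Re a ^+ 2 + complex.Im a ^+ 2.
  by case: a => u v /=; ring.
set A := complex.Re a ^+ 2 + _; set p := nsq x; have := nsq_ge0 y; rewrite le_eqVlt => /orP[/eqP h _|h].
  have y0 : y = 0 by apply: nsq_eq0.
  by rewrite /A /a y0 ip0r /= expr0n addr0 nsq0 mulr0.
move: h; set q := nsq y => h h2; have : 0 <= q * (q * p - A) by lra.
by rewrite pmulr_rge0 // subr_ge0 mulrC.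
Qed.

Lemma cauchy_schwarz_Re x y : `|complex.Re (ip x y)| <= hnorm ip x * hnorm ip y.
Proof.
rewrite -ler_sqr ?nnegrE ?normr_ge0 ?mulr_ge0 ?hnorm_ge0 //.
rewrite real_normK ?num_real // exprMn !hnorm_sqr.
by apply: le_trans (cauchy_schwarz x y); rewrite lerDl sqr_ge0.
Qed.

Lemma hnormD x y : hnorm ip (x + y) <= hnorm ip x + hnorm ip y.
Proof.
rewrite -ler_sqr ?nnegrE ?addr_ge0 ?hnorm_ge0 // sqrrD !hnorm_sqr nsqD.
have := le_trans (ler_norm _) (cauchy_schwarz_Re x y).
lra.
Qed.

Lemma hnormD3 x y z : hnorm ip (x - z) <= hnorm ip (x - y) + hnorm ip (y - z).
Proof. by have := hnormD (x - y) (y - z); rewrite addrA subrK. Qed.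

Lemma ip_closed x y : in_closure ip (fun z => ip z y = 0) x -> ip x y = 0.
Proof.
move=> h; have : complex.Re (ip x y) ^+ 2 + complex.Im (ip x y) ^+ 2 <= 0.
  apply: ler_of_eps => e e0; rewrite add0r.
  have Y1 : 0 < nsq y + 1 by rewrite ltr_wpDl ?nsq_ge0.
  (* The [+ 1] allows [y = 0]; Cauchy-Schwarz then bounds [|<x - z, y>|^2] by [e]. *)
  have [|z [zy hz]] := h (Num.sqrt (e / (nsq y + 1))); first by rewrite sqrtr_gt0 divr_gt0.
  have := cauchy_schwarz (x - z) y; rewrite ipBl zy subr0 => /le_trans; apply.
  have : nsq (x - z) <= e / (nsq y + 1).
    have <- : Num.sqrt (e / (nsq y + 1)) ^+ 2 = e / (nsq y + 1).
      by rewrite sqr_sqrtr // ltW // divr_gt0.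
    by rewrite -hnorm_sqr ler_sqr ?nnegrE ?hnorm_ge0 ?sqrtr_ge0 // ltW.
  move=> /(ler_wpM2r (nsq_ge0 y)) /le_trans; apply.
  by rewrite -mulrA ger_pMr // mulrC ler_pdivrMr // mul1r lerDl.
case: (ip x y) => a b /= H.
have /eqP : a ^+ 2 + b ^+ 2 = 0 by apply/eqP; rewrite eq_le H addr_ge0 ?sqr_ge0.
by rewrite paddr_eq0 ?sqr_ge0 // !sqrf_eq0 => /andP[/eqP -> /eqP ->].
Qed.

Lemma in_closure_sub (S1 S2 : V -> Prop) x : (forall y, S1 y -> S2 y) ->
  in_closure ip S1 x -> in_closure ip S2 x.
Proof. by move=> h hx e /hx [y [/h ? ?]]; exists y. Qed.

Lemma in_closure_mem (S : V -> Prop) x : S x -> in_closure ip S x.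
Proof. by move=> h e e0; exists x; rewrite subrr hnorm0. Qed.

Lemma in_closure_idem (S : V -> Prop) x : in_closure ip (in_closure ip S) x -> in_closure ip S x.
Proof.
move=> h e e0; have e2 : 0 < e / 2 by rewrite divr_gt0.
have [y [/(_ _ e2) [z [Sz yz]] xy]] := h _ e2; exists z; split=> //.
by apply: le_lt_trans (hnormD3 x y z) _; rewrite [e]splitr ltrD.
Qed.

Lemma closed_closure (S : V -> Prop) : S 0 ->
  (forall a x y, S x -> S y -> S (a *: x + y)) -> closed_subspace ip (in_closure ip S).
Proof.
move=> S0 SD; split; [exact: in_closure_mem| |exact: in_closure_idem].
move=> a x y hx hy e e0.
have e2 : 0 < e / 2 by rewrite divr_gt0.
set c := Num.sqrt (complex.Re a ^+ 2 + complex.Im a ^+ 2).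
have c1 : 0 < c + 1 by rewrite ltr_wpDl ?sqrtr_ge0.
have [|x' [Sx hx']] := hx (e / 2 / (c + 1)); first by rewrite divr_gt0.
have [y' [Sy hy']] := hy _ e2.
exists (a *: x' + y'); split; first exact: SD.
have -> : a *: x + y - (a *: x' + y') = a *: (x - x') + (y - y').
  by rewrite scalerBr opprD !addrA; congr (_ - _); rewrite addrAC.
apply: le_lt_trans (hnormD _ _) _; rewrite [e]splitr ltr_leD ?(ltW hy') //.
have -> : hnorm ip (a *: (x - x')) = c * hnorm ip (x - x').
  by rewrite /hnorm -!/(nsq _) nsqZ sqrtrM // addr_ge0 ?sqr_ge0.
apply: (@le_lt_trans _ _ ((c + 1) * hnorm ip (x - x'))).
  by rewrite ler_wpM2r ?hnorm_ge0 // lerDl.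
by rewrite mulrC -ltr_pdivlMr.
Qed.

Definition orthocomp (S : V -> Prop) x := forall y, S y -> ip x y = 0.

Lemma closed_orthocomp (S : V -> Prop) : closed_subspace ip (orthocomp S).
Proof.
split=> [y _|a x y hx hy z Sz|x hx y Sy]; first by rewrite ip0l.
  by rewrite ipDl ipZl hx // hy // mulr0 addr0.
by apply: ip_closed; apply: in_closure_sub hx => z; apply.
Qed.

(** * Projection onto closed subspaces *)

(** Direct method: [J y = |y|^2 - 2 Re (f y)] is bounded below on [M], the parallelogram identity
    makes a minimizing sequence Cauchy, and the vanishing first variation at its limit [x] says that
    [x] represents [f] on [M]. *)
Lemma riesz (M : V -> Prop) (f : V -> R[i]) (C : R) :
  closed_subspace ip M ->
  (forall a x y, f (a *: x + y) = a * f x + f y) ->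
  (forall x, complex.Re (f x) <= C * hnorm ip x) ->
  exists2 x, M x & forall y, M y -> f y = ip y x.
Proof.
move=> [M0 MD Mc] flin fC.
have f0 : f 0 = 0.
  by have := flin 1 0 0; rewrite scale1r addr0 mul1r => /esym/(canRL (addrK _)); rewrite subrr.
have fZ a x : f (a *: x) = a * f x by rewrite -[a *: x]addr0 flin f0 addr0.
have fD x y : f (x + y) = f x + f y by rewrite -[x]scale1r flin mul1r scale1r.
have MZ a x : M x -> M (a *: x) by move=> Mx; rewrite -[a *: x]addr0; apply: MD.
have MDD x y : M x -> M y -> M (x + y) by move=> Mx My; rewrite -[x]scale1r; apply: MD.
pose J y := nsq y - 2 * complex.Re (f y).
pose E : classical_sets.set R := fun r => exists2 y, M y & r = J y.
have EJ y : M y -> E (J y) by exists y.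
have Elb : classical_sets.has_lbound E.
  exists (- C ^+ 2) => _ [y My ->]; rewrite /J -hnorm_sqr.
  have := fC y; have := sqr_ge0 (hnorm ip y - C).
  set h := hnorm _ _; set g := complex.Re _; nra.
have Einf : classical_sets.has_inf E by split=> //; exists (J 0); apply: EJ.
set m := inf E.
have mJ y : M y -> m <= J y by move=> My; apply: ge_inf => //; apply: EJ.
have /boolp.choice [u hu] : forall j : nat, exists y, M y /\ J y < m + j.+1%:R^-1.
  move=> j; have j0 : 0 < j.+1%:R^-1 :> R by rewrite invr_gt0 ltr0n.
  by have [_ [y My ->] h] := inf_adherent j0 Einf; exists y.
have uM j : M (u j) by case: (hu j).
have uJ j : J (u j) < m + j.+1%:R^-1 by case: (hu j).
have par i j : nsq (u i - u j) < 2 * i.+1%:R^-1 + 2 * j.+1%:R^-1.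
  (* The midpoint of [u i] and [u j] lies in [M], so its [J]-value is at least [m]; this bounds the
     distance of the two points. *)
  have := mJ _ (MZ (2^-1)%:C%C _ (MDD _ _ (uM i) (uM j))).
  move: (uJ i) (uJ j); rewrite /J fZ fD nsqZR ReZ ReD nsqD nsqB.
  set p := complex.Re (f (u i)); set q := complex.Re (f (u j)).
  set ei := i.+1%:R^-1; set ej := j.+1%:R^-1; set r := complex.Re (ip _ _); set a := nsq (u i); set b := nsq (u j).
  rewrite exprVn; have -> : (2 ^+ 2)^-1 = 4^-1 :> R by congr (_^-1); ring.
  lra.
have [eps e0|x ux] := Hc (u := u).
  have [N hN] := @ex_invn_lt R (eps ^+ 2 / 4) ltac:(by rewrite divr_gt0 // exprn_gt0).
  exists N => i j /hN hi /hN hj; have := par i j; rewrite -hnorm_sqr => h.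
  rewrite -(ltr_pXn2r (n := 2)) // ?nnegrE ?hnorm_ge0 ?(ltW e0) //.
  apply: lt_trans h _; move: hi hj; set ei := i.+1%:R^-1; set ej := j.+1%:R^-1; lra.
have Mx : M x.
  by apply: Mc => e /ux [N /(_ N (leqnn _)) h]; exists (u N); rewrite hnormB.
have ReE y : M y -> complex.Re (f y) = complex.Re (ip x y).
  move=> My; apply/esym/eqP; rewrite -subr_eq0; set d := _ - _; set q := nsq y.
  have q0 : 0 <= q by apply: nsq_ge0.
  (* This is [J (x + t y) - J x], estimated with some [u i] close to [x] in place of [x]. *)
  have var t : 0 <= t ^+ 2 * q + 2 * t * d.
    apply: ler_of_eps => e e0.
    set K := 2 * `|t| * hnorm ip y + 1.
    have K0 : 0 < K by rewrite ltr_wpDl // !mulr_ge0 ?hnorm_ge0.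
    have e2 : 0 < e / 2 by rewrite divr_gt0.
    have [N1 h1] := ex_invn_lt e2.
    have [N2 h2] := ux (e / 2 / K) ltac:(by rewrite divr_gt0).
    have {}h1 := h1 _ (leq_maxl N1 N2); have {}h2 := h2 _ (leq_maxr N1 N2).
    set i := maxn N1 N2 in h1 h2.
    have := mJ _ (MD t%:C%C _ _ My (uM i)); have := uJ i.
    rewrite /J flin ReD ReZ nsqD nsqZR ipZl ReZ [ip y _]ipC Re_conjc.
    have : `|complex.Re (ip (u i - x) y)| <= e / 2 / K * hnorm ip y.
      apply: le_trans (cauchy_schwarz_Re _ _) _.
      by rewrite ler_wpM2r ?hnorm_ge0 // ltW.
    move=> /(ler_wpM2l (normr_ge0 (2 * t))); rewrite -normrM.
    move=> /(le_trans (ler_norm _)).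
    have -> : `|2 * t| * (e / 2 / K * hnorm ip y) = (2 * `|t| * hnorm ip y) / K * (e / 2).
      by rewrite normrM ger0_norm //; ring.
    have : (2 * `|t| * hnorm ip y) / K <= 1 by rewrite ler_pdivrMr // mul1r lerDl.
    move=> /(ler_wpM2r (ltW e2)) + /le_trans hh; move=> {hh}/hh.
    rewrite ipBl ReB /d -/q; move: h1.
    set aa := _^-1; set b1 := complex.Re (f y); set b2 := complex.Re (ip x y).
    set b3 := complex.Re (ip (u i) y); set b4 := complex.Re (f (u i)).
    rewrite mul1r; lra.
  have q1 : 0 < q + 1 by rewrite ltr_wpDl.
  (* Close to the minimizer [- d / q] of the quadratic, with [q + 1] to allow [q = 0]; the value is
     a nonpositive multiple of [d ^+ 2], so [d = 0]. *)
  have := var (- d / (q + 1)).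
  have -> : (- d / (q + 1)) ^+ 2 * q + 2 * (- d / (q + 1)) * d
          = - (d ^+ 2 * ((q + 2) / (q + 1) ^+ 2)) by field; rewrite gt_eqF.
  rewrite oppr_ge0 pmulr_lle0 ?divr_gt0 ?exprn_gt0 ?ltr_wpDl // => h.
  by rewrite -sqrf_eq0 eq_le h sqr_ge0.
exists x => // y My; apply: eq_complex_Re.
  by rewrite ReE // ipC Re_conjc.
by rewrite -fZ ReE; [rewrite ipC Re_conjc ipZl|exact: MZ].
Qed.

(** The projection is the vector of [M] representing [y |-> <y, x>] on [M]. *)
Lemma orthogonal_projection (M : V -> Prop) x : closed_subspace ip M ->
  exists2 p, M p & forall y, M y -> ip (x - p) y = 0.
Proof.
move=> Mc.
have [||p Mp hp] := @riesz M (fun y => ip y x) (hnorm ip x) Mc.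
- by move=> a y z; rewrite ipDl ipZl.
- by move=> y; rewrite mulrC; apply: le_trans (ler_norm _) (cauchy_schwarz_Re _ _).
by exists p => // y My; rewrite ipBl [ip x y]ipC [ip p y]ipC hp // subrr.
Qed.

Lemma dense_of_total (S : V -> Prop) : S 0 ->
  (forall a x y, S x -> S y -> S (a *: x + y)) ->
  (forall x, orthocomp S x -> x = 0) -> forall x, in_closure ip S x.
Proof.
move=> S0 SD St x.
have [p Sp hp] := orthogonal_projection x (closed_closure S0 SD).
suff -> : x = p by [].
apply/eqP; rewrite -subr_eq0; apply/eqP/St => y Sy; apply: hp.
exact: in_closure_mem.
Qed.

(** * Bounded operators and adjoints *)

Lemma lin_op0 A : linear_op A -> A 0 = 0.
Proof.
move=> h; have := h 1 0 0; rewrite !scale1r addr0 => /esym/(canRL (addrK _)).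
by rewrite subrr.
Qed.

Lemma lin_opZ A a x : linear_op A -> A (a *: x) = a *: A x.
Proof. by move=> h; rewrite -[a *: x]addr0 h lin_op0 // addr0. Qed.

Lemma lin_opD A x y : linear_op A -> A (x + y) = A x + A y.
Proof. by move=> h; rewrite -[x]scale1r h !scale1r. Qed.

Lemma lin_opB A x y : linear_op A -> A (x - y) = A x - A y.
Proof. by move=> h; rewrite -scaleN1r addrC h scaleN1r addrC. Qed.

Lemma lin_op_sum A (I : Type) (r : seq I) (P : pred I) (F : I -> V) : linear_op A ->
  A (\sum_(i <- r | P i) F i) = \sum_(i <- r | P i) A (F i).
Proof.
move=> h; apply: (big_morph A); [by move=> x y; rewrite lin_opD | exact: lin_op0].
Qed.

Lemma bounded_nneg A : bounded_op ip A ->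
  exists M : R, 0 <= M /\ forall x, hnorm ip (A x) <= M * hnorm ip x.
Proof.
move=> [_ [M h]]; exists `|M|; split=> // x; apply: le_trans (h x) _.
by rewrite ler_wpM2r ?hnorm_ge0 ?ler_norm.
Qed.

Lemma bounded_op0 A : bounded_op ip A -> A 0 = 0.
Proof. by case=> + _; apply: lin_op0. Qed.

Lemma bounded_id : bounded_op ip id.
Proof. by split=> //; exists 1 => x; rewrite mul1r. Qed.

Lemma bounded_comp A B : bounded_op ip A -> bounded_op ip B -> bounded_op ip (fun x => A (B x)).
Proof.
move=> hA hB; split.
  by move=> a x y; rewrite hB.1 hA.1.
have [M [M0 hM]] := bounded_nneg hA; have [N [N0 hN]] := bounded_nneg hB.
by exists (M * N) => x; rewrite -mulrA (le_trans (hM _)) // ler_wpM2l.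
Qed.

Lemma bounded_add A B : bounded_op ip A -> bounded_op ip B -> bounded_op ip (fun x => A x + B x).
Proof.
move=> [lA [M hA]] [lB [N hB]]; split.
  by move=> a x y; rewrite lA lB scalerDr addrACA.
by exists (M + N) => x; rewrite mulrDl (le_trans (hnormD _ _)) // lerD.
Qed.

Lemma bounded_sub A B : bounded_op ip A -> bounded_op ip B -> bounded_op ip (fun x => A x - B x).
Proof.
move=> [lA [M hA]] [lB [N hB]]; split.
  by move=> a x y; rewrite lA lB opprD scalerBr addrACA.
by exists (M + N) => x; rewrite mulrDl (le_trans (hnormD _ _)) // hnormN lerD.
Qed.

Lemma bounded_iter A r : bounded_op ip A -> bounded_op ip (iter r A).
Proof.
by move=> hA; elim: r => [|r IH]; [exact: bounded_id | exact: bounded_comp].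
Qed.

Lemma adj_ex A : bounded_op ip A -> exists B, is_adjoint ip A B.
Proof.
move=> hA; suff /boolp.choice [B hB] : forall y, exists z, forall x, ip (A x) y = ip x z.
  by exists B => x y.
move=> y; have [M [M0 hM]] := bounded_nneg hA.
have [|||z _ hz] := @riesz (fun=> True) (fun x => ip (A x) y) (M * hnorm ip y).
- by split.
- by move=> a x x'; rewrite hA.1 ipDl ipZl.
- move=> x; apply: le_trans (ler_norm _) (le_trans (cauchy_schwarz_Re _ _) _).
  by rewrite mulrAC ler_wpM2r ?hnorm_ge0.
by exists z => x; rewrite hz.
Qed.

Lemma adjP A x y : bounded_op ip A -> ip (A x) y = ip x (adj ip A y).
Proof.
move=> /adj_ex hA; exact: (ClassicalEpsilon.epsilon_spec (inhabits (fun x : V => x)) (is_adjoint ip A) hA).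
Qed.

Lemma adjPr A x y : bounded_op ip A -> ip x (A y) = ip (adj ip A x) y.
Proof. by move=> hA; rewrite ipC adjP // -ipC. Qed.

Lemma is_adjoint_sym A B : is_adjoint ip A B -> is_adjoint ip B A.
Proof. by move=> h x y; rewrite ipC -h -ipC. Qed.

Lemma adj_unique A B : bounded_op ip A -> is_adjoint ip A B -> adj ip A = B.
Proof.
move=> hA h; apply/boolp.funext => y; apply: ip_inj => x.
by rewrite ipC -adjP // h -ipC.
Qed.

(** [|A' y|^2 = <A A' y, y> <= M |A' y| |y|], and one factor [|A' y|] cancels. *)
Lemma bounded_adj A : bounded_op ip A -> bounded_op ip (adj ip A).
Proof.
move=> hA; split.
  move=> a x y; apply: ip_inj => z.
  by rewrite ipDl ipZl -!adjPr // ipDl ipZl.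
have [M [M0 hM]] := bounded_nneg hA; exists M => y.
have : nsq (adj ip A y) <= M * hnorm ip (adj ip A y) * hnorm ip y.
  rewrite /nsq -adjP //; apply: le_trans (ler_norm _) (le_trans (cauchy_schwarz_Re _ _) _).
  by rewrite ler_wpM2r ?hnorm_ge0.
rewrite -hnorm_sqr; have := hnorm_ge0 (adj ip A y); set h := hnorm _ _.
rewrite le_eqVlt => /orP[/eqP <- _|h0]; first by rewrite mulr_ge0 ?hnorm_ge0.
by rewrite expr2 mulrAC -subr_ge0 -mulrBl pmulr_lge0 // subr_ge0.
Qed.

Lemma adjK A : bounded_op ip A -> adj ip (adj ip A) = A.
Proof.
by move=> hA; apply: adj_unique (bounded_adj hA) _ => x y; rewrite adjPr.
Qed.

Lemma contraction_nsq A : contraction ip A <-> forall x, nsq (A x) <= nsq x.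
Proof. by split=> h x; have := h x; rewrite hnorm_le. Qed.

Lemma contraction_adj A : bounded_op ip A -> contraction ip A -> contraction ip (adj ip A).
Proof.
move=> hA cA y; have := hnorm_ge0 (adj ip A y).
rewrite le_eqVlt => /orP[/eqP <- |h0]; first by rewrite hnorm_ge0.
rewrite -(ler_pM2l h0) -expr2 hnorm_sqr /nsq -adjP //.
apply: le_trans (ler_norm _) (le_trans (cauchy_schwarz_Re _ _) _).
by rewrite ler_wpM2r ?hnorm_ge0.
Qed.

(** If [|A x| = |x|], then [|A'A x - x|^2 = |A'A x|^2 - |x|^2 <= 0]. A condition on norms becomes a
    linear equation. *)
Lemma contraction_isom A x : bounded_op ip A -> contraction ip A ->
  nsq (A x) = nsq x <-> adj ip A (A x) = x.
Proof.
move=> hA cA; split=> [h|h]; last by rewrite /nsq adjP // h.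
apply/eqP; rewrite -subr_eq0; apply/eqP/nsq_eq0/eqP.
rewrite eq_le nsq_ge0 andbT nsqB -adjPr // -/(nsq _) h.
have /contraction_nsq/(_ (A x)) := contraction_adj hA cA; rewrite h; lra.
Qed.

(** * Square roots of positive operators *)

Section SquareRoot.
Variable C : V -> V.
Hypothesis lC : linear_op C.
Hypothesis sC : is_adjoint ip C C.
Hypothesis cC : contraction ip C.

(* [1 - sqrtY n] approximates the square root of [1 - C]; [sqrty] is the same
   iteration for the scalar [C = 1] and majorizes all the norms. *)
Fixpoint sqrtY (n : nat) (x : V) : V :=
  if n is m.+1 then (2^-1)%:C%C *: (C x + sqrtY m (sqrtY m x)) else 0.

Fixpoint sqrty (n : nat) : R := if n is m.+1 then 2^-1 * (1 + sqrty m ^+ 2) else 0.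

Lemma sqrty_ge0 n : 0 <= sqrty n.
Proof. by case: n => [|n] //=; rewrite mulr_ge0 ?addr_ge0 ?sqr_ge0 ?invr_ge0. Qed.

Lemma sqrty_le1 n : sqrty n <= 1.
Proof. elim: n => [|n IH] /=; first exact: ler01.
have := sqrty_ge0 n; nra. Qed.

Lemma sqrty_leS n : sqrty n <= sqrty n.+1.
Proof. by rewrite /=; have := sqr_ge0 (sqrty n - 1); nra. Qed.

Lemma sqrty_le n m : (n <= m)%N -> sqrty n <= sqrty m.
Proof.
move=> /subnK <-; elim: (m - n)%N => [|d IH] //; exact: le_trans IH (sqrty_leS _).
Qed.

Lemma sqrtY_lin n : linear_op (sqrtY n).
Proof.
elim: n => [|n IH] a x y /=; first by rewrite scaler0 addr0.
by rewrite lC !IH addrACA -scalerDr [LHS]scalerDr !scalerA mulrC.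
Qed.

Lemma hnorm_half x : hnorm ip ((2^-1)%:C%C *: x) = 2^-1 * hnorm ip x.
Proof. by rewrite hnormZR ger0_norm // invr_ge0. Qed.

Lemma sqrtY_norm n x : hnorm ip (sqrtY n x) <= sqrty n * hnorm ip x.
Proof.
elim: n x => [|n IH] x /=; first by rewrite hnorm0 mul0r.
rewrite hnorm_half -mulrA ler_pM2l ?invr_gt0 // mulrDl mul1r.
apply: le_trans (hnormD _ _) _; rewrite lerD // (le_trans (IH _)) //.
by rewrite expr2 -mulrA ler_wpM2l ?sqrty_ge0.
Qed.

Lemma sqrtY_sym n : is_adjoint ip (sqrtY n) (sqrtY n).
Proof.
elim: n => [|n IH] x y /=; first by rewrite ip0l ip0r.
by rewrite ipZl ipZr ipDl ipDr sC !IH conjc_real.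
Qed.

(** Rests on [Y Y - Z Z = Y (Y - Z) + (Y - Z) Z]; the scalar increments obey the same recursion. *)
Lemma sqrtY_diffS n x :
  hnorm ip (sqrtY n.+1 x - sqrtY n x) <= (sqrty n.+1 - sqrty n) * hnorm ip x.
Proof.
elim: n x => [|n IH] x; first by have := sqrtY_norm 1 x; rewrite /= !subr0.
set Y := sqrtY n.+1; set Z := sqrtY n.
have -> : sqrtY n.+2 x - Y x = (2^-1)%:C%C *: (Y (Y x - Z x) + (Y (Z x) - Z (Z x))).
  have E : Y x = (2^-1)%:C%C *: (C x + Z (Z x)) by [].
  have -> : sqrtY n.+2 x = (2^-1)%:C%C *: (C x + Y (Y x)) by [].
  rewrite [X in _ - X]E -scalerBr opprD addrACA subrr add0r.
  by rewrite (lin_opB _ _ (sqrtY_lin n.+1 : linear_op Y)) addrA subrK.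
rewrite hnorm_half; have -> : sqrty n.+2 - sqrty n.+1 =
    2^-1 * (sqrty n.+1 * (sqrty n.+1 - sqrty n) + (sqrty n.+1 - sqrty n) * sqrty n).
  have hu : sqrty n.+1 = 2^-1 * (1 + sqrty n ^+ 2) by [].
  have -> : sqrty n.+2 = 2^-1 * (1 + sqrty n.+1 ^+ 2) by [].
  by rewrite [X in _ - X = _]hu; move: (sqrty n.+1) (sqrty n) => u v; ring.
rewrite -mulrA ler_pM2l ?invr_gt0 // mulrDl; apply: le_trans (hnormD _ _) _.
apply: lerD.
  by apply: le_trans (sqrtY_norm _ _) _; rewrite -mulrA ler_wpM2l ?sqrty_ge0.
apply: le_trans (IH _) _; rewrite -mulrA ler_wpM2l ?subr_ge0 ?sqrty_leS //.
exact: sqrtY_norm.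
Qed.

Lemma sqrtY_diff n m x : (n <= m)%N ->
  hnorm ip (sqrtY m x - sqrtY n x) <= (sqrty m - sqrty n) * hnorm ip x.
Proof.
move=> /subnK <-; elim: (m - n)%N => [|d IH]; first by rewrite !subrr hnorm0 mul0r.
apply: le_trans (hnormD3 _ (sqrtY (d + n) x) _) _.
by apply: le_trans (lerD (sqrtY_diffS _ _) IH) _; rewrite -mulrDl addrA subrK.
Qed.

Let sqrty_values : classical_sets.set R := fun r => exists n, r = sqrty n.

Let s := sup sqrty_values.

Let sqrty_has_sup : classical_sets.has_sup sqrty_values.
Proof.
by split; [exists (sqrty 0); exists 0%N | exists 1 => _ [n ->]; exact: sqrty_le1].
Qed.

Let sqrty_le_sup n : sqrty n <= s.
Proof. by apply: ub_le_sup; [case: sqrty_has_sup | exists n]. Qed.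

Let sup_le1 : s <= 1.
Proof. by apply: ge_sup => [|_ [n ->]]; [exists (sqrty 0); exists 0%N | exact: sqrty_le1]. Qed.

Let sup_approx eps : 0 < eps -> exists n, s - sqrty n < eps.
Proof.
move=> e0; have [_ [n ->] h] := sup_adherent e0 sqrty_has_sup.
by exists n; rewrite -/s in h; lra.
Qed.

Let sup_small (r K : R) : (forall n, r <= (s - sqrty n) * K) -> r <= 0.
Proof.
move=> h; apply: ler_of_eps => e e0; rewrite add0r.
have K1 : 0 < `|K| + 1 by rewrite ltr_wpDl.
have [n hn] := sup_approx (divr_gt0 e0 K1).
apply: le_trans (h n) _; have hs : 0 <= s - sqrty n by rewrite subr_ge0.
apply: (@le_trans _ _ ((s - sqrty n) * (`|K| + 1))).
  by rewrite ler_wpM2l // (le_trans (ler_norm K)) // lerDl.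
by rewrite -ler_pdivlMr // ltW.
Qed.

(** The scalar iterates increase to [s], and their increments dominate those of the operator
    iterates, which therefore converge pointwise with an explicit error. *)
Let sqrtY_lim : exists Z : V -> V, forall n x,
  hnorm ip (Z x - sqrtY n x) <= (s - sqrty n) * hnorm ip x.
Proof.
suff /boolp.choice [Z hZ] : forall x, exists z, forall n,
    hnorm ip (z - sqrtY n x) <= (s - sqrty n) * hnorm ip x by exists Z.
move=> x; have [e e0|z hz] := Hc (u := fun n => sqrtY n x).
  have h1 : 0 < hnorm ip x + 1 by rewrite ltr_wpDl ?hnorm_ge0.
  have [N hN] := sup_approx (divr_gt0 e0 h1).
  have key m p : (N <= m)%N -> (m <= p)%N -> hnorm ip (sqrtY p x - sqrtY m x) < e.
    move=> hm hp; apply: le_lt_trans (sqrtY_diff x hp) _.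
    apply: (@le_lt_trans _ _ ((s - sqrty N) * (hnorm ip x + 1))).
      apply: ler_pM; rewrite ?hnorm_ge0 ?subr_ge0 ?sqrty_le ?lerDl //.
      by rewrite lerB ?sqrty_le_sup ?sqrty_le.
    by rewrite -ltr_pdivlMr.
  exists N => m p hm hp; case: (leqP m p) => h; last exact: key (ltnW h).
  by rewrite hnormB; apply: key.
exists z => n; apply: ler_of_eps => e /hz [N hN].
apply: le_trans (hnormD3 _ (sqrtY (maxn N n) x) _) _; rewrite addrC lerD //.
  apply: le_trans (sqrtY_diff x (leq_maxr N n)) _.
  by rewrite ler_wpM2r ?hnorm_ge0 // lerB.
by rewrite hnormB ltW // hN // leq_maxl.
Qed.

(** The limit satisfies [2 Z = C + Z Z], that is [(1 - Z)^2 = 1 - C]. Linearity, symmetry and this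
    equation pass to the limit because a norm bounded by [(s - sqrty n) K] for all [n] is zero. *)
Lemma pos_sqrt_exists : exists B, is_pos_sqrt ip (fun x => x - C x) B.
Proof.
have [Z hZ] := sqrtY_lim.
have s0 n : 0 <= s - sqrty n by rewrite subr_ge0.
have small0 x K : (forall n, hnorm ip x <= (s - sqrty n) * K) -> x = 0.
  by move=> /sup_small h; apply: hnorm_eq0; apply/eqP; rewrite eq_le h hnorm_ge0.
have lZ : linear_op Z.
  move=> a x y; apply/eqP; rewrite -subr_eq0; apply/eqP.
  pose c := Num.sqrt (complex.Re a ^+ 2 + complex.Im a ^+ 2).
  apply: (small0 _ (hnorm ip (a *: x + y) + (c * hnorm ip x + hnorm ip y))) => n.
  have -> : Z (a *: x + y) - (a *: Z x + Z y) =
     (Z (a *: x + y) - sqrtY n (a *: x + y)) - (a *: (Z x - sqrtY n x) + (Z y - sqrtY n y)).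
    by rewrite sqrtY_lin scalerBr addrACA -opprD [in RHS]opprB addrA subrK.
  rewrite mulrDr; apply: le_trans (hnormD _ _) _; rewrite hnormN lerD //.
  rewrite mulrDr; apply: le_trans (hnormD _ _) _; rewrite lerD //.
  have -> : hnorm ip (a *: (Z x - sqrtY n x)) = c * hnorm ip (Z x - sqrtY n x).
    by rewrite /hnorm -!/(nsq _) nsqZ sqrtrM // addr_ge0 ?sqr_ge0.
  by rewrite mulrCA ler_wpM2l ?sqrtr_ge0.
have bZ x : hnorm ip (Z x) <= hnorm ip x.
  have := hnormD (Z x - sqrtY 0 x) (sqrtY 0 x); rewrite subrK hnorm0 addr0.
  move=> /le_trans; apply; apply: le_trans (hZ _ _) _.
  by rewrite /= subr0 ler_piMl ?hnorm_ge0 ?sup_le1.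
have symZ : is_adjoint ip Z Z.
  have symRe x y : complex.Re (ip (Z x) y) = complex.Re (ip x (Z y)).
    apply/eqP; rewrite -subr_eq0 -normr_le0; apply/eqP.
    apply/eqP; apply: (@sup_small _ (2 * (hnorm ip x * hnorm ip y))) => n.
    have -> : complex.Re (ip (Z x) y) - complex.Re (ip x (Z y)) =
        complex.Re (ip (Z x - sqrtY n x) y) - complex.Re (ip x (Z y - sqrtY n y)).
      by rewrite ipBl ipBr !ReB sqrtY_sym; ring.
    apply: le_trans (ler_normB _ _) _.
    have h1 := cauchy_schwarz_Re (Z x - sqrtY n x) y.
    have h2 := cauchy_schwarz_Re x (Z y - sqrtY n y).
    have h3 := ler_wpM2r (hnorm_ge0 y) (hZ n x).
    have h4 := ler_wpM2l (hnorm_ge0 x) (hZ n y).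
    have := le_trans h1 h3; have := le_trans h2 h4.
    set u := hnorm ip x; set v := hnorm ip y; set w := s - _.
    rewrite [u * (w * v)]mulrCA -[w * u * v]mulrA.
    set t := w * (u * v); rewrite mulrCA -/t; lra.
  by move=> x y; apply: eq_complex_Re => //; rewrite -!ipZl -lin_opZ.
have eqZ x : Z x + Z x = C x + Z (Z x).
  (* The constant 4 counts [Z x - Y' x] twice and each half of [Z Z - Y Y] once. *)
  apply/eqP; rewrite -subr_eq0; apply/eqP; apply: (small0 _ (4 * hnorm ip x)) => n.
  set Y := sqrtY n; set Y' := sqrtY n.+1.
  have Y'E : Y' x + Y' x = C x + Y (Y x).
    rewrite /Y' /= -/Y -scalerDl; have -> : (2^-1)%:C%C + (2^-1)%:C%C = 1 :> R[i].
      by apply/eqP; rewrite eq_complex /= addr0 eqxx andbT; apply/eqP; lra.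
    by rewrite scale1r.
  have -> : Z x + Z x - (C x + Z (Z x)) =
      (Z x - Y' x) + (Z x - Y' x) - (Z (Z x - Y x) + (Z (Y x) - Y (Y x))).
    have -> : Z (Z x - Y x) + (Z (Y x) - Y (Y x)) = Z (Z x) - Y (Y x).
      by rewrite (lin_opB _ _ lZ) addrA subrK.
    rewrite addrACA -opprD Y'E -[RHS]addrA; congr (_ + _).
    by rewrite opprB !opprD addrA addrNK.
  apply: le_trans (hnormD _ _) _; rewrite hnormN.
  have h1 := hnormD (Z x - Y' x) (Z x - Y' x).
  have h2 := hnormD (Z (Z x - Y x)) (Z (Y x) - Y (Y x)).
  have h3 := hZ n.+1 x; rewrite -/Y' in h3.
  have h3' : (s - sqrty n.+1) * hnorm ip x <= (s - sqrty n) * hnorm ip x.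
    by rewrite ler_wpM2r ?hnorm_ge0 // lerB // sqrty_leS.
  have h4 := le_trans (bZ (Z x - Y x)) (hZ n x).
  have h5 := le_trans (hZ n (Y x)) (ler_wpM2l (s0 n) (sqrtY_norm n x)).
  have h6 : (s - sqrty n) * (sqrty n * hnorm ip x) <= (s - sqrty n) * hnorm ip x.
    by rewrite ler_wpM2l // ler_piMl ?hnorm_ge0 ?sqrty_le1.
  rewrite -/Y in h5.
  set t := (s - sqrty n) * hnorm ip x in h3' h4 h6 *.
  have -> : (s - sqrty n) * (4 * hnorm ip x) = 4 * t by rewrite /t; ring.
  lra.
exists (fun x => x - Z x); split.
- apply: bounded_sub bounded_id _; split=> //; exists 1 => x; by rewrite mul1r.
(* Symmetry makes [<Z x, x>] real, and contractivity of [Z] bounds it by [|x|^2]. *)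
- move=> x; rewrite lecE ipBl ip_nsq.
  have := symZ x x; rewrite [ip x (Z x)]ipC; have := cauchy_schwarz_Re (Z x) x.
  case: (ip (Z x) x) => a b /= h [] hb.
  have -> : b = 0 by lra.
  rewrite subr0 eqxx /= subr_ge0 -hnorm_sqr expr2; apply: le_trans (ler_norm _) (le_trans h _).
  by rewrite ler_wpM2r ?hnorm_ge0.
- by move=> x; rewrite (lin_opB _ _ lZ) -addrA -opprD addrA eqZ addrK.
Qed.

End SquareRoot.

(** Polarization: [g] vanishes on the diagonal, and testing it at [x + y] and [i x + y] shows it to
    be both antisymmetric and symmetric. This supplies the self-adjointness that [is_pos_sqrt] does
    not record. *)
Lemma pos_op_sym A : linear_op A -> (forall x, 0 <= ip (A x) x) -> is_adjoint ip A A.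
Proof.
move=> lA pA; pose g x y := ip (A x) y - ip x (A y).
have gxx x : g x x = 0.
  have := pA x; rewrite /g [ip x _]ipC lecE; case: (ip (A x) x) => a b /= /andP[/eqP -> _].
  by rewrite oppr0 subrr.
have gD x y : g x y + g y x = 0.
  have : g (x + y) (x + y) = g x x + g y y + (g x y + g y x).
    by rewrite /g lin_opD // !ipDl !ipDr; ring.
  by rewrite !gxx !add0r => <-.
have gi x y : g x y - g y x = 0.
  have := gD ('i%C *: x) y; rewrite /g lin_opZ // !ipZl !ipZr.
  have -> : conjc 'i%C = - 'i%C :> R[i] by apply/eqP; rewrite eq_complex /= oppr0 !eqxx.
  move=> h; apply: (@mulfI _ 'i%C); first by rewrite eq_complex /= oner_eq0 andbF.
  by rewrite mulr0 -h; ring.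
move=> x y; apply/eqP; rewrite -subr_eq0 -/(g x y); apply/eqP.
have h : 2 * g x y = 0 by rewrite -[RHS](addr0 0) -{1}(gD x y) -(gi x y); ring.
by move/eqP: h; rewrite mulf_eq0 pnatr_eq0 => /eqP.
Qed.

(** The remainder of the projection of [x] onto the closed range lies in the kernel of [B], so it is
    orthogonal to [x] as well as to the projection. *)
Lemma closure_range_sym B x : bounded_op ip B -> is_adjoint ip B B ->
  in_closure ip (range B) x <-> forall y, B y = 0 -> ip x y = 0.
Proof.
move=> hB sB; split.
  move=> hx y By; apply: ip_closed; apply: in_closure_sub hx => _ [z ->].
  by rewrite sB By ip0r.
move=> hx; have cr : closed_subspace ip (in_closure ip (range B)).
  apply: closed_closure; first by exists 0; rewrite lin_op0 //; case: hB.
  by move=> a _ _ [u ->] [v ->]; exists (a *: u + v); rewrite hB.1.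
have [p hp hxp] := orthogonal_projection x cr.
have Bxp : B (x - p) = 0.
  apply: ip_total => z; rewrite sB; apply: hxp; apply: in_closure_mem; by exists z.
suff -> : x = p by [].
apply/eqP; rewrite -subr_eq0; apply/eqP/nsq_eq0; rewrite /nsq ipBr.
by rewrite (hxp _ hp) subr0 ip_eq0C // hx.
Qed.

(** [|D y|^2 = <D D y, y>] shows that the defect operator [D] and [1 - T'T] have the same kernel.
    Defect spaces are handled through [1 - T'T] from here on. *)
Lemma defect_spaceP T x : bounded_op ip T -> contraction ip T ->
  defect_space ip T x <-> forall y, adj ip T (T y) = y -> ip x y = 0.
Proof.
move=> hT cT.
have hTT := bounded_comp (bounded_adj hT) hT.
have [bB pB BB] : is_pos_sqrt ip (fun x => x - adj ip T (T x)) (defect_op ip T).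
  apply: (ClassicalEpsilon.epsilon_spec (inhabits (fun x : V => x))).
  apply: pos_sqrt_exists; first exact: hTT.1.
    by move=> u v; rewrite -adjPr // adjP.
  by move=> u; apply: le_trans (contraction_adj hT cT _) (cT u).
have sB := pos_op_sym bB.1 pB.
rewrite /defect_space closure_range_sym //; split=> h y hy; apply: h.
  apply: nsq_eq0; rewrite /nsq sB BB hy subrr.
  by rewrite ip0r.
have /eqP := BB y; rewrite hy (lin_op0 bB.1) eq_sym subr_eq0 eq_sym.
by move/eqP.
Qed.

(** * Finite orthonormal families and orthonormal bases *)

Section FiniteFamily.
Variables (N : nat) (b : 'I_N -> V).

Definition fproj x : V := \sum_(i < N) ip x (b i) *: b i.

Lemma fproj_lin : linear_op fproj.
Proof.
move=> a x y; rewrite /fproj scaler_sumr -big_split /=; apply: eq_bigr => i _.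
by rewrite ipDl ipZl scalerDl scalerA.
Qed.

Lemma fproj_sym : is_adjoint ip fproj fproj.
Proof.
move=> x y; rewrite ip_suml ip_sumr; apply: eq_bigr => i _.
by rewrite ipZl ipZr [ip (b i) y]ipC mulrC.
Qed.

Lemma fproj0 x : (forall i, ip x (b i) = 0) -> fproj x = 0.
Proof. by move=> h; rewrite /fproj big1 // => i _; rewrite h scale0r. Qed.

Lemma fproj_span x : span_fin b (fproj x).
Proof. by exists (fun i => ip x (b i)). Qed.

Hypothesis ob : Defs.orthonormal ip b.

Lemma ip_span (c : 'I_N -> R[i]) i : ip (\sum_(j < N) c j *: b j) (b i) = c i.
Proof.
rewrite ip_suml (bigD1 i) //= ipZl ob eqxx mulr1 big1 ?addr0 // => j ji.
by rewrite ipZl ob (negPf ji) mulr0.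
Qed.

Lemma span_finP x : span_fin b x <-> fproj x = x.
Proof.
split=> [[c ->]|<-]; last exact: fproj_span.
by rewrite /fproj; apply: eq_bigr => i _; rewrite ip_span.
Qed.

Lemma fproj_idem x : fproj (fproj x) = fproj x.
Proof. exact/span_finP/fproj_span. Qed.

Lemma fproj_orth x y : ip (fproj x) (y - fproj y) = 0.
Proof. by rewrite fproj_sym (lin_opB _ _ fproj_lin) fproj_idem subrr ip0r. Qed.

Lemma fproj_compl x : fproj (x - fproj x) = 0.
Proof. by rewrite (lin_opB _ _ fproj_lin) fproj_idem subrr. Qed.

Lemma nsq_fproj x : nsq x = nsq (fproj x) + nsq (x - fproj x).
Proof. by rewrite -nsqD_orth ?fproj_orth // addrC subrK. Qed.

Lemma nsq_fproj_compl x : nsq (x - fproj x) = nsq x - nsq (fproj x).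
Proof. by rewrite [nsq x]nsq_fproj addrAC subrr add0r. Qed.

Lemma bounded_fproj : bounded_op ip fproj.
Proof.
split; first exact: fproj_lin.
by exists 1 => x; rewrite mul1r hnorm_le [nsq x]nsq_fproj lerDl nsq_ge0.
Qed.

(** In the basis [b] the map is a square matrix acting on row vectors; injectivity makes it row
    free, hence invertible. *)
Lemma finite_dim_surjective A : linear_op A ->
  (forall x, span_fin b (A x)) -> (forall x, span_fin b x -> A x = 0 -> x = 0) ->
  forall y, span_fin b y -> exists2 x, span_fin b x & A x = y.
Proof.
move=> lA AS Ainj y [d ->].
pose M : 'M[R[i]]_N := \matrix_(i, j) ip (A (b i)) (b j).
have AE (c : 'rV_N) : A (\sum_(i < N) c 0 i *: b i) = \sum_(j < N) (c *m M) 0 j *: b j.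
  rewrite lin_op_sum //.
  under [RHS]eq_bigr => j _ do rewrite mxE scaler_suml.
  rewrite exchange_big; apply: eq_bigr => i _; rewrite lin_opZ //.
  have /span_finP <- := AS (b i); rewrite scaler_sumr; apply: eq_bigr => j _.
  by rewrite mxE scalerA.
have : row_free M.
  apply: inj_row_free => c c0; pose v := \sum_(i < N) c 0 i *: b i.
  have v0 : v = 0.
    apply: Ainj; first by exists (c 0).
    by rewrite AE c0 big1 // => j _; rewrite mxE scale0r.
  by apply/rowP => j; rewrite mxE -[LHS](ip_span (c 0)) -/v v0 ip0l.
rewrite row_free_unit => uM; pose c := (\row_j d j) *m invmx M.
exists (\sum_(i < N) c 0 i *: b i); first by exists (c 0).
by rewrite AE mulmxKV //; apply: eq_bigr => j _; rewrite mxE.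
Qed.

End FiniteFamily.

(* The partial isometry sending one family to the other is injective, hence onto. *)
Lemma span_fin_eq_dim N (b b' : 'I_N -> V) :
  Defs.orthonormal ip b -> Defs.orthonormal ip b' ->
  (forall x, span_fin b' x -> span_fin b x) -> forall x, span_fin b x -> span_fin b' x.
Proof.
move=> ob ob' sub; pose A x := \sum_(i < N) ip x (b i) *: b' i.
have lA : linear_op A.
  move=> a x y; rewrite /A scaler_sumr -big_split /=; apply: eq_bigr => i _.
  by rewrite ipDl ipZl scalerDl scalerA.
have AS x : span_fin b' (A x) by exists (fun i => ip x (b i)).
move=> x /(finite_dim_surjective ob lA (fun x => sub _ (AS x))) [].
  move=> y /(span_finP ob) yb Ay.
  rewrite -yb; apply: fproj0 => i.
  by rewrite -[LHS](ip_span ob' (fun i => ip y (b i))) -/(A y) Ay ip0l.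
by move=> y _ <-.
Qed.

Section OrthonormalSequence.
Variable e : nat -> V.
Hypothesis oe : Defs.orthonormal ip e.

Lemma orthonormal_trunc j : Defs.orthonormal ip (fun i : 'I_j => e i).
Proof. by move=> i i'; rewrite oe. Qed.

Lemma proj_lin j : linear_op (proj ip e j).
Proof. exact: fproj_lin. Qed.

Lemma proj_sym j : is_adjoint ip (proj ip e j) (proj ip e j).
Proof. exact: fproj_sym. Qed.

Lemma proj_idem j x : proj ip e j (proj ip e j x) = proj ip e j x.
Proof. exact: (fproj_idem (@orthonormal_trunc j)). Qed.

Lemma proj_span j x : span_fin (fun i : 'I_j => e i) x <-> proj ip e j x = x.
Proof. exact: (span_finP (@orthonormal_trunc j)). Qed.

Lemma bounded_proj j : bounded_op ip (proj ip e j).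
Proof. exact: (bounded_fproj (@orthonormal_trunc j)). Qed.

Lemma orthonormal_sum (f : nat -> V) j m :
  \sum_(i < j) ip (e m) (e i) *: f i = if (m < j)%N then f m else 0.
Proof.
case: ltnP => mj.
  rewrite (bigD1 (Ordinal mj)) //= oe eqxx scale1r big1 ?addr0 // => i ij.
  rewrite oe; case: eqP => [E|_]; last by rewrite scale0r.
  by case/eqP: ij; apply: val_inj.
rewrite big1 // => i _; rewrite oe; case: eqP => [E|_]; last by rewrite scale0r.
by have := leq_trans (ltn_ord i) mj; rewrite -E ltnn.
Qed.

Lemma proj_basis j m : proj ip e j (e m) = if (m < j)%N then e m else 0.
Proof. exact: orthonormal_sum. Qed.

Lemma ip_proj j x m : ip (proj ip e j x) (e m) = if (m < j)%N then ip x (e m) else 0.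
Proof. by rewrite proj_sym proj_basis; case: ifP => // _; rewrite ip0r. Qed.

Lemma proj_eq0 j x : proj ip e j x = 0 <-> forall m, (m < j)%N -> ip x (e m) = 0.
Proof.
split=> [h m mj|h]; first by have := ip_proj j x m; rewrite h ip0l mj.
by apply: fproj0 => i; apply: h.
Qed.

Lemma proj_ge i j x : (i <= j)%N -> proj ip e j (proj ip e i x) = proj ip e i x.
Proof.
move=> ij; rewrite /(proj ip e i x) lin_op_sum; last exact: proj_lin.
apply: eq_bigr => m _; rewrite (lin_opZ _ _ (proj_lin j)) proj_basis.
by rewrite (leq_trans (ltn_ord m) ij).
Qed.

Lemma proj_le i j x : (i <= j)%N -> proj ip e i (proj ip e j x) = proj ip e i x.
Proof.
move=> ij; apply: ip_inj => y; rewrite !proj_sym; congr (ip x _).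
exact: proj_ge.
Qed.

Lemma nsq_proj_compl j x : nsq (x - proj ip e j x) = nsq x - nsq (proj ip e j x).
Proof. exact: (nsq_fproj_compl (@orthonormal_trunc j)). Qed.

Lemma nsq_proj_le i j x : (i <= j)%N -> nsq (proj ip e i x) <= nsq (proj ip e j x).
Proof. by move=> ij; rewrite -(proj_le x ij) -subr_ge0 -nsq_proj_compl nsq_ge0. Qed.

Lemma bounded_proj_compl j : bounded_op ip (fun x => x - proj ip e j x).
Proof. exact: bounded_sub bounded_id (bounded_proj j). Qed.

Lemma proj_compl_basis j m : e m - proj ip e j (e m) = if (m < j)%N then 0 else e m.
Proof. by rewrite proj_basis; case: ifP; rewrite ?subrr ?subr0. Qed.

Lemma ip_proj_compl j x y : ip (x - proj ip e j x) y = ip x (y - proj ip e j y).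
Proof. by rewrite ipBl ipBr proj_sym. Qed.

Lemma nsq_proj_complE j x :
  nsq (x - proj ip e j x) = complex.Re (ip (x - proj ip e j x) x).
Proof.
by rewrite /nsq ipBr [ip _ (proj _ _ _ _)]ip_eq0C ?subr0 // (fproj_orth (@orthonormal_trunc j)).
Qed.

Lemma ip_proj_orth j x y : ip (proj ip e j x) (y - proj ip e j y) = 0.
Proof. exact: (fproj_orth (@orthonormal_trunc j)). Qed.

Lemma proj_proj_compl j x : proj ip e j (x - proj ip e j x) = 0.
Proof. exact: (fproj_compl (@orthonormal_trunc j)). Qed.

Lemma onb_of_total : (forall x, (forall m, ip x (e m) = 0) -> x = 0) -> onb ip e.
Proof.
move=> te; have spanP x : span_seq e x <-> exists N, proj ip e N x = x.
  split=> [[N [c xE]]|[N <-]]; exists N; last by exists (fun i => ip x (e i)).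
  by apply/proj_span; exists c.
split=> // x; apply: dense_of_total.
- by exists 0%N, (fun=> 0); rewrite big_ord0.
- move=> a y z /spanP [N yN] /spanP [M zM]; apply/spanP; exists (maxn N M).
  by rewrite proj_lin -yN -zM !proj_ge ?leq_maxl ?leq_maxr.
- move=> y hy; apply: te => m; apply: hy; apply/spanP; exists m.+1.
  by rewrite proj_basis ltnSn.
Qed.

End OrthonormalSequence.

Section OrthonormalBasis.
Variable e : nat -> V.
Hypothesis he : onb ip e.

Lemma onb_total x : (forall m, ip x (e m) = 0) -> x = 0.
Proof.
move=> h; apply: nsq_eq0; rewrite /nsq ip_closed //.
apply: in_closure_sub (he.2 x) => _ [N [c ->]]; apply: ip_eq0C.
by rewrite ip_sumr big1 // => i _; rewrite ipZr h mulr0.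
Qed.

Lemma onb_inj x y : (forall m, ip x (e m) = ip y (e m)) -> x = y.
Proof.
move=> h; apply/eqP; rewrite -subr_eq0; apply/eqP/onb_total => m.
by rewrite ipBl h subrr.
Qed.

(** The coefficients of [A' y] and [B' y] involve only the vectors [A (e m)] and [B (e m)], so the
    adjoints agree. *)
Lemma onb_ext A B : bounded_op ip A -> bounded_op ip B ->
  (forall m, A (e m) = B (e m)) -> forall x, A x = B x.
Proof.
move=> hA hB h x; apply: ip_inj => y; rewrite !adjP //; congr (ip x _).
apply: onb_inj => m; apply: (can_inj (@conjcK R)).
by rewrite -[LHS]ipC -[RHS]ipC -!adjP // h.
Qed.

End OrthonormalBasis.

(** * Operators shifting the tail of an orthonormal basis *)

Lemma is_adjoint_iter A B r : is_adjoint ip A B -> is_adjoint ip (iter r A) (iter r B).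
Proof.
move=> h; elim: r => [|r IH] x y //=.
by rewrite h IH -iterS iterSr.
Qed.

Lemma contraction_iter A r : contraction ip A -> contraction ip (iter r A).
Proof. by move=> h; elim: r => [|r IH] x //=; exact: le_trans (h _) (IH x). Qed.

Section PartialShift.
Variables (e : nat -> V) (T : V -> V) (n k : nat).
Hypothesis he : onb ip e.
Hypothesis hT : bounded_op ip T.
Hypothesis T_shift : forall m, (n <= m)%N -> T (e m) = e (m + k)%N.
Hypothesis T_head : forall x, proj ip e (n + k) (T (proj ip e n x)) = T (proj ip e n x).

Let oe : Defs.orthonormal ip e := he.1.
Local Notation Ts := (adj ip T).
Local Notation P := (proj ip e).
Local Notation Q x := (x - proj ip e n x).

Let hTs : bounded_op ip Ts := bounded_adj hT.

Lemma iter_shift r m : (n <= m)%N -> iter r T (e m) = e (m + k * r)%N.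
Proof.
move=> nm; elim: r => [|r IH] /=; first by rewrite muln0 addn0.
by rewrite IH T_shift ?(leq_trans nm) ?leq_addr // mulnS -addnA [(k * r + k)%N]addnC.
Qed.

(** The coefficient along [e j] is [<e (m + k), T (e j)>]: the shift decides it for [j >= n], and
    for [j < n] it vanishes because [T (e j)] lies in the span of the first [n + k] basis
    vectors. *)
Lemma adj_shift m : (n <= m)%N -> Ts (e (m + k)%N) = e m.
Proof.
move=> nm; apply: (onb_inj he) => j; rewrite -adjPr //.
case: (leqP n j) => nj; first by rewrite T_shift // !oe eqn_add2r.
have Tj : P (n + k)%N (T (e j)) = T (e j).
  by have := T_head (e j); rewrite (proj_basis oe) nj.
rewrite -Tj -(proj_sym e) (proj_basis oe) ltn_add2r ltnNge nm /= ip0l oe.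
by case: eqP => // E; move: nj; rewrite -E ltnNge nm.
Qed.

Lemma iter_adj_shift r m : (n <= m)%N -> iter r Ts (e (m + k * r)%N) = e m.
Proof.
move=> nm; elim: r => [|r IH]; first by rewrite muln0 addn0.
by rewrite iterSr mulnS [(k + _)%N]addnC addnA adj_shift ?(leq_trans nm) ?leq_addr.
Qed.

(** [T^r] is isometric on the tail; it suffices to follow basis vectors there and back. *)
Lemma iter_adj_iter r x : iter r Ts (iter r T (Q x)) = Q x.
Proof.
apply: (onb_ext he (A := fun x => iter r Ts (iter r T (Q x))) (B := fun x => Q x)).
- apply: (bounded_comp (bounded_iter r hTs)); apply: (bounded_comp (bounded_iter r hT)).
  exact: bounded_proj_compl.
- exact: bounded_proj_compl.
move=> m; rewrite (proj_compl_basis oe); case: ltnP => nm.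
  by rewrite (bounded_op0 (bounded_iter r hT)) (bounded_op0 (bounded_iter r hTs)).
by rewrite iter_shift // iter_adj_shift.
Qed.

Lemma iter_compl_iter_adj r x : iter r T (Q (iter r Ts x)) = x - P (n + k * r) x.
Proof.
apply: (onb_ext he (A := fun x => iter r T (Q (iter r Ts x)))
  (B := fun x => x - P (n + k * r) x)).
- apply: (bounded_comp (bounded_iter r hT)).
  apply: (bounded_comp (bounded_proj_compl oe n)); exact: bounded_iter.
- exact: bounded_proj_compl.
move=> m; rewrite (proj_compl_basis oe); case: ltnP => nm.
  rewrite [X in iter r T X](_ : _ = 0) ?(bounded_op0 (bounded_iter r hT)) //.
  (* For [j >= n], [<T'^r e_m, e_j> = <e_m, e_(j+kr)> = 0] because [m < n + k r]; so [T'^r e_m] has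
     no tail component. *)
  apply: (onb_inj he) => j; rewrite ip0l ip_proj_compl (proj_compl_basis oe).
  case: ltnP => nj; first by rewrite ip0r.
  rewrite (is_adjoint_sym (is_adjoint_iter r (fun x y => adjP x y hT))) iter_shift //.
  rewrite oe; case: eqP => // E; move: nm; rewrite E ltn_add2r ltnNge nj //.
have [d ->] : exists d, m = (n + d + k * r)%N.
  by exists (m - (n + k * r))%N; rewrite addnAC subnKC.
rewrite iter_adj_shift ?leq_addr // (proj_compl_basis oe) ltnNge leq_addr /=.
by rewrite iter_shift ?leq_addr.
Qed.

(** Since [T'^r T^r] fixes the tail part of [x], the images of head and tail are orthogonal and the
    tail part keeps its norm. *)
Lemma nsq_iter r x :
  nsq (iter r T x) = nsq (iter r T (P n x)) + nsq x - nsq (P n x).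
Proof.
have lr := (bounded_iter r hT).1.
have -> : iter r T x = iter r T (P n x) + iter r T (Q x).
  by rewrite -lin_opD // addrC subrK.
have adjr := is_adjoint_iter r (fun x y => adjP x y hT).
rewrite nsqD_orth; last by rewrite adjr iter_adj_iter (ip_proj_orth oe).
rewrite [X in _ + X](_ : _ = nsq (Q x)); first by rewrite (nsq_proj_compl oe) addrA.
by rewrite /nsq adjr iter_adj_iter.
Qed.

Lemma adj_iter_proj r : adj ip (fun x => iter r T (P n x)) = fun x => P n (iter r Ts x).
Proof.
apply: adj_unique.
  exact: bounded_comp (bounded_iter r hT) (bounded_proj oe n).
by move=> x y; rewrite (is_adjoint_iter r (fun x y => adjP x y hT)) (proj_sym e).
Qed.

(** The tail part of [T'^r x] has squared norm [<T^r Q T'^r x, x>], which equals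
    [|x - P_(n+kr) x|^2]. *)
Lemma nsq_iter_adj r x :
  nsq (iter r Ts x) = nsq (P n (iter r Ts x)) + nsq x - nsq (P (n + k * r) x).
Proof.
have adjr := is_adjoint_iter r (fun x y => adjP x y hT).
rewrite -addrA -(nsq_proj_compl oe).
rewrite {1}(_ : iter r Ts x = P n (iter r Ts x) + Q (iter r Ts x)); last by rewrite addrC subrK.
rewrite nsqD_orth ?(ip_proj_orth oe) //; congr (_ + _).
by rewrite !(nsq_proj_complE oe) -iter_compl_iter_adj adjr.
Qed.

(** [T'T] fixes the tail and, being self-adjoint, preserves the head. The right-hand side is
    [P_n - F_1'F_1]. *)
Lemma sub_adj_comp x : x - Ts (T x) = P n x - P n (Ts (T (P n x))).
Proof.
have TsTQ y : Ts (T (Q y)) = Q y := iter_adj_iter 1 y.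
have QTsT : Q (Ts (T (P n x))) = 0.
  apply: ip_total => y.
  by rewrite ip_proj_compl -adjPr // adjP // TsTQ (ip_proj_orth oe).
have -> : P n (Ts (T (P n x))) = Ts (T (P n x)).
  by apply/esym/eqP; rewrite -subr_eq0; apply/eqP.
have /eqP := TsTQ x; rewrite (lin_opB _ _ hT.1) (lin_opB _ _ hTs.1) subr_eq => /eqP ->.
by rewrite opprD addrA subKr.
Qed.

Lemma sub_comp_adj x : x - T (Ts x) = P (n + k) x - T (P n (Ts x)).
Proof.
have TQTs : T (Q (Ts x)) = x - P (n + k) x by have := iter_compl_iter_adj 1 x; rewrite muln1.
move/eqP: TQTs; rewrite (lin_opB _ _ hT.1) subr_eq => /eqP ->.
by rewrite opprD addrA subKr.
Qed.

End PartialShift.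

(** Induction splitting the innermost [T]: [S (y - P y)] is carried by [T^s] to the new top term,
    and the rest is the induction hypothesis at [A y]. The sum includes [j = s], one term more than
    in [Frop]. *)
Lemma iter_shift_decomp (S A T : V -> V) (P : V -> V) s y :
  (forall y, T y = A y + S (y - P y)) -> linear_op T ->
  (forall r y, iter r T (S (y - P y)) = iter r.+1 S (y - P y)) ->
  iter s T y = iter s A y +
    \sum_(1 <= j < s.+1) iter j S (iter (s - j) A y - P (iter (s - j) A y)).
Proof.
move=> TE lT TS; elim: s y => [|s IH] y; first by rewrite big_geq //= addr0.
rewrite iterSr TE (lin_opD _ _ (_ : linear_op (iter s T))); last first.
  by elim: s {IH} => [|s IH] a u v //=; rewrite IH lT.
rewrite IH TS [in RHS]big_nat_recr // subnn [iter s.+1 A y]iterSr -[LHS]addrA; congr (_ + (_ + _)).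

by apply: eq_big_nat => j /andP[_]; rewrite ltnS => js; rewrite -iterSr subSn.
Qed.

Section ShiftPlusFiniteRank.
Variables (e : nat -> V) (S F T : V -> V) (n k : nat).
Hypothesis he : onb ip e.
Hypothesis hS : bounded_op ip S.
Hypothesis hT : bounded_op ip T.
Hypothesis S_shift : forall m, S (e m) = e (m + k)%N.
Hypothesis TSF : forall x, T x = S x + F x.
Hypothesis F1Q : forall x, F1op ip S F e n (x - proj ip e n x) = 0.

Let oe : Defs.orthonormal ip e := he.1.
Local Notation P := (proj ip e).

Lemma F1op_sub x : F1op ip S F e n x = T x - S (x - P n x).
Proof. by rewrite /F1op TSF (lin_opB _ _ hS.1) opprB [S x + F x]addrC -addrA [S x + _]addrCA subrr addr0. Qed.

(** As [F_1 = T - S (1 - P_n)], the equation [F_1 (1 - P_n) = 0] says that [T] and [S] agree on the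
    tail; consequently [F_1 = T P_n]. *)
Lemma shift_compl x : T (x - P n x) = S (x - P n x).
Proof.
have := F1Q x; rewrite F1op_sub (proj_proj_compl oe) subr0 => /eqP.
by rewrite subr_eq0 => /eqP.
Qed.

Lemma F1opE : F1op ip S F e n = fun x => T (P n x).
Proof.
apply/boolp.funext => x; rewrite F1op_sub -shift_compl -(lin_opB _ _ hT.1).
by rewrite opprB addrCA subrr addr0.
Qed.

Lemma T_shift_of_F1op m : (n <= m)%N -> T (e m) = e (m + k)%N.
Proof.
move=> nm; have := shift_compl (e m).
by rewrite (proj_compl_basis oe) ltnNge nm /= S_shift.
Qed.

(** The expansion of [T^r] is [F_r + S^r (1 - P_n)], and the last term is [T^r (1 - P_n)];
    subtracting it leaves [T^r P_n]. *)
Lemma FropE r : (1 <= r)%N -> Frop ip S F e n r = fun x => iter r T (P n x).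
Proof.
move=> r1; apply/boolp.funext => x.
have lr := (bounded_iter r hT).1.
have TS s y : iter s T (S (y - P n y)) = iter s.+1 S (y - P n y).
  apply: (onb_ext he (A := fun y => iter s T (S (y - P n y)))
    (B := fun y => iter s.+1 S (y - P n y))).
  - apply: (bounded_comp (bounded_iter s hT)); apply: (bounded_comp hS).
    exact: bounded_proj_compl.
  - by apply: (bounded_comp (bounded_iter s.+1 hS)); exact: bounded_proj_compl.
  move=> m; rewrite (proj_compl_basis oe); case: ltnP => nm.
    by rewrite (bounded_op0 hS) (bounded_op0 (bounded_iter s hT)) (bounded_op0 (bounded_iter s.+1 hS)).
  rewrite iterSr S_shift.
  rewrite (iter_shift T_shift_of_F1op) ?(leq_trans nm) ?leq_addr //.
  by rewrite (iter_shift (n := n) (fun m _ => S_shift m)) ?(leq_trans nm) ?leq_addr.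
have TE y : T y = F1op ip S F e n y + S (y - P n y).
  by rewrite F1op_sub subrK.
have Fr y : iter r T y = Frop ip S F e n r y + iter r S (y - P n y).
  rewrite (iter_shift_decomp r y TE hT.1 TS) big_nat_recr //= subnn /= addrA //.
rewrite -[RHS](subKr (iter r T x)) -(lin_opB _ _ lr) Fr.
rewrite (_ : iter r T (x - P n x) = iter r S (x - P n x)) ?addrK //.
case: r r1 {lr Fr} => // r _; rewrite iterSr shift_compl; exact: TS.
Qed.

End ShiftPlusFiniteRank.

(** * Completely non-unitary contractions and defect spaces *)

Section NonUnitary.
Variable T : V -> V.
Hypothesis hT : bounded_op ip T.
Hypothesis cT : contraction ip T.
Local Notation Ts := (adj ip T).

(** For a contraction this is the space of its unitary part, the largest reducing subspace on which
    it is unitary. *)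
Definition iter_isometric A x :=
  forall r, nsq (iter r A x) = nsq x /\ nsq (iter r (adj ip A) x) = nsq x.

Lemma adj_iter A r : bounded_op ip A -> adj ip (iter r A) = iter r (adj ip A).
Proof.
move=> hA; apply: adj_unique; first exact: bounded_iter.
exact: is_adjoint_iter (fun x y => adjP x y hA).
Qed.

Lemma iter_isometric_adj A x : bounded_op ip A ->
  iter_isometric A x <-> iter_isometric (adj ip A) x.
Proof. by move=> hA; rewrite /iter_isometric adjK //; split=> h r; case: (h r). Qed.

Lemma iter_isometric_apply A x : bounded_op ip A -> contraction ip A ->
  iter_isometric A x -> iter_isometric A (A x).
Proof.
move=> hA cA h; have Ax : nsq (A x) = nsq x by case: (h 1%N).
move=> r; rewrite Ax -iterSr; split; first by case: (h r.+1).
case: r => [|r] //; rewrite iterSr (_ : adj ip A (A x) = x); first by case: (h r).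
exact/contraction_isom.
Qed.

(** By [contraction_isom] the norm equalities amount to [T'^r T^r x = x] and [T^r T'^r x = x], so
    the set is the orthogonal complement of the ranges of [1 - T'^r T^r] and [1 - T^r T'^r]. *)
Lemma closed_iter_isometric : closed_subspace ip (iter_isometric T).
Proof.
pose S z := exists r y, z = y - iter r Ts (iter r T y) \/ z = y - iter r T (iter r Ts y).
suff -> : iter_isometric T = orthocomp S by exact: closed_orthocomp.
apply/boolp.funext => x; apply/boolp.propext.
have hTs := bounded_adj hT.
have ad r : is_adjoint ip (iter r T) (iter r Ts).
  exact: is_adjoint_iter (fun x y => adjP x y hT).
have key A : bounded_op ip A -> contraction ip A ->
    nsq (A x) = nsq x <-> forall y, ip x (y - adj ip A (A y)) = 0.
  move=> hA cA; rewrite contraction_isom //; split=> [Ax y|h].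
    by rewrite ipBr -adjP // adjPr // Ax subrr.
  apply/esym/ip_inj => y; apply/eqP; rewrite -subr_eq0 -adjPr // adjP // -ipBr.
  exact/eqP.
have keyT r : nsq (iter r T x) = nsq x <-> forall y, ip x (y - iter r Ts (iter r T y)) = 0.
  by have := key _ (bounded_iter r hT) (contraction_iter r cT); rewrite adj_iter.
have keyTs r : nsq (iter r Ts x) = nsq x <-> forall y, ip x (y - iter r T (iter r Ts y)) = 0.
  have := key _ (bounded_iter r hTs) (contraction_iter r (contraction_adj hT cT)).
  by rewrite adj_iter // adjK.
split=> [h _ [r [y [->|->]]]|h r].
- by have /keyT := (h r).1; apply.
- by have /keyTs := (h r).2; apply.
split; [apply/keyT|apply/keyTs] => y; apply: h; exists r, y; by [left|right].
Qed.

(** The vectors of [iter_isometric] form a reducing subspace on which [T] is unitary. Conversely, on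
    any such subspace [T'] inverts [T], so all powers of both are isometric. *)
Lemma cnu_iff : completely_non_unitary ip T <-> forall x, iter_isometric T x -> x = 0.
Proof.
have hTs := bounded_adj hT; have cTs := contraction_adj hT cT.
have invTs x : iter_isometric T x -> iter_isometric T (Ts x).
  move=> /(iter_isometric_adj x hT) h; apply/(iter_isometric_adj _ hT).
  exact: iter_isometric_apply.
split=> [cnu|h M [_ MT MTs] [iso surj] x Mx].
  apply: (cnu (iter_isometric T)).
    split; [exact: closed_iter_isometric| |] => x hx.
      exact: iter_isometric_apply.
    exact: invTs.
  split=> [x /(_ 1%N) [h _]|y hy]; first exact/hnorm_eq.
  exists (Ts y); split.
    exact: invTs.
  by have [/(_ (hy 1%N).2)] := contraction_isom y hTs cTs; rewrite adjK.
have TsT z : M z -> Ts (T z) = z.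
  by move=> /iso Mz; apply/contraction_isom => //; apply/hnorm_eq.
have isoT z : M z -> nsq (T z) = nsq z by move=> /iso /hnorm_eq.
have isoTs z : M z -> nsq (Ts z) = nsq z.
  by move=> /surj [y [My <-]]; rewrite TsT // isoT.
apply: h => r; split.
  suff : M (iter r T x) /\ nsq (iter r T x) = nsq x by case.
  by elim: r => [|r [IH1 IH2]] //=; split; [exact: MT|rewrite isoT].
suff : M (iter r Ts x) /\ nsq (iter r Ts x) = nsq x by case.
by elim: r => [|r [IH1 IH2]] //=; split; [exact: MTs|rewrite isoTs].
Qed.

Lemma defect_kerP x : Ts (T x) = x <-> forall z, defect_space ip T z -> ip x z = 0.
Proof.
split=> [hx z /(defect_spaceP z hT cT) h|h].
  by apply: ip_eq0C; apply: h.
apply/esym/eqP; rewrite -subr_eq0; apply/eqP/ip_total => y.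
have -> : ip (x - Ts (T x)) y = ip x (y - Ts (T y)).
  by rewrite ipBl ipBr -adjPr // adjP.
(* Uses that the range of [1 - T'T] lies in the defect space. *)
apply: h; apply/(defect_spaceP _ hT cT) => z hz.
by rewrite ipBl -[ip (Ts _) z]adjPr // adjP // hz subrr.
Qed.

End NonUnitary.

Lemma proj_ker_orth (e : nat -> V) j x : Defs.orthonormal ip e ->
  (forall y, proj ip e j y = 0 -> ip x y = 0) <-> proj ip e j x = x.
Proof.
move=> oe; split=> [h|<- y hy]; last by rewrite proj_sym hy ip0r.
apply/esym/eqP; rewrite -subr_eq0; apply/eqP/nsq_eq0.
by rewrite nsq_proj_complE // /= ip_eq0C // h // proj_proj_compl.
Qed.

Lemma proj_addn (e : nat -> V) n k x :
  proj ip e (n + k) x = proj ip e n x + fproj (fun i : 'I_k => e (n + i)%N) x.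
Proof. by rewrite /proj big_split_ord. Qed.

(** * Contractivity, unitary part and defect spaces of an operator shifting a basis tail *)

Section Model.
Variables (e : nat -> V) (T : V -> V) (n k : nat).
Hypothesis he : onb ip e.
Hypothesis hT : bounded_op ip T.
Hypothesis T_shift : forall m, (n <= m)%N -> T (e m) = e (m + k)%N.
Hypothesis T_head : forall x, proj ip e (n + k) (T (proj ip e n x)) = T (proj ip e n x).

Let oe : Defs.orthonormal ip e := he.1.
Local Notation Ts := (adj ip T).
Local Notation P := (proj ip e).

Let N1 := nsq_iter he hT T_shift T_head.
Let N2 := nsq_iter_adj he hT T_shift T_head.
Let adjF r := adj_iter_proj n he hT r.

(** By the two norm identities the conditions at [r] say that [T^r] and [T'^r] are contractive;
    [r = 1] already gives [T], and the rest follows from it. *)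
Lemma contraction_iff_head :
  (forall r, (1 <= r)%N -> forall x,
     hnorm ip (iter r T (P n x)) <= hnorm ip (P n x) /\
     hnorm ip (adj ip (fun x => iter r T (P n x)) x) <= hnorm ip (P (n + k * r) x))
  <-> contraction ip T.
Proof.
split=> [h|cT r _ x].
  apply/contraction_nsq => x; have [+ _] := h 1%N isT x; have := N1 1 x.
  rewrite hnorm_le /=; lra.
rewrite adjF !hnorm_le; split.
  have /contraction_nsq/(_ x) := contraction_iter r cT; have := N1 r x; lra.
have /contraction_nsq/(_ x) := contraction_iter r (contraction_adj hT cT).
have := N2 r x; lra.
Qed.

Lemma iter_isometric_iff_head x :
  (forall r, (1 <= r)%N ->
     hnorm ip (iter r T (P n x)) = hnorm ip (P n x) /\
     hnorm ip (adj ip (fun x => iter r T (P n x)) x) = hnorm ip (P (n + k * r) x))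
  <-> iter_isometric T x.
Proof.
split=> [h [|r]|h r _] //.
  have [] := h r.+1 isT; rewrite adjF !hnorm_eq.
  have := N1 r.+1 x; have := N2 r.+1 x; lra.
rewrite adjF !hnorm_eq; case: (h r); have := N1 r x; have := N2 r x; lra.
Qed.

Section Converse.
Hypothesis cT : contraction ip T.
Hypothesis rk : has_dim ip (range (fun x => x - Ts (T x))) n.

(** The range lies in the span of the first [n] basis vectors by [sub_adj_comp], and both have
    dimension [n]. *)
Lemma range_TsT x : range (fun x => x - Ts (T x)) x <-> P n x = x.
Proof.
have [b [ob hb]] := rk.
have sub z : span_fin b z -> span_fin (fun i : 'I_n => e i) z.
  move=> /hb [y ->]; apply/(proj_span oe).
  by rewrite (sub_adj_comp he hT T_shift T_head) (lin_opB _ _ (proj_lin e n)) !(proj_idem oe).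
split; first by move=> /hb /sub /(proj_span oe).
move=> /(proj_span oe) h; apply/hb.
exact: (span_fin_eq_dim (@orthonormal_trunc _ oe n) ob sub).
Qed.

Lemma fixed_TsT x : Ts (T x) = x <-> P n x = 0.
Proof.
split=> [h|h]; last first.
  apply/esym/eqP; rewrite -subr_eq0 (sub_adj_comp he hT T_shift T_head) h.
  by rewrite (bounded_op0 hT) (bounded_op0 (bounded_adj hT)) (lin_op0 (proj_lin e n)) subrr.
apply/(proj_eq0 oe) => m mn; have /range_TsT [z ->] : P n (e m) = e m.
  by rewrite (proj_basis oe) mn.
by rewrite ipBr -adjP // adjPr // h subrr.
Qed.

(** If [T T' x = x], then [T'T] fixes [T' x], so [P_n T' x = 0] and [sub_comp_adj] applies.
    Conversely, [P_n T' x = 0] because [T P_n] has its range in the first [n + k] coordinates. *)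
Lemma fixed_TTs x : T (Ts x) = x <-> P (n + k) x = 0.
Proof.
have E := sub_comp_adj he hT T_shift T_head x; split=> h.
  have /fixed_TsT PTs : Ts (T (Ts x)) = Ts x by rewrite h.
  by move: E; rewrite PTs (bounded_op0 hT) h subrr subr0.
have PTs : P n (Ts x) = 0.
  apply: ip_total => z; rewrite proj_sym -adjPr // -T_head -(proj_sym e) h.
  by rewrite ip0l.
apply/esym/eqP; rewrite -subr_eq0 E h PTs.
by rewrite (bounded_op0 hT) subrr.
Qed.

Lemma defect_space_head x : defect_space ip T x <-> P n x = x.
Proof.
rewrite (defect_spaceP x hT cT) -proj_ker_orth //.
by split=> h y /fixed_TsT; apply: h.
Qed.

Lemma defect_space_adj_head x : defect_space ip (adj ip T) x <-> P (n + k) x = x.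
Proof.
rewrite (defect_spaceP x (bounded_adj hT) (contraction_adj hT cT)) adjK // -proj_ker_orth //.
by split=> h y /fixed_TTs; apply: h.
Qed.

(** The defect spaces are spanned by the first [n] and the first [n + k] basis vectors, so their
    difference is spanned by the [k] vectors [e (n + i)]. *)
Lemma defect_dims :
  [/\ forall x, defect_space ip T x -> defect_space ip Ts x,
      has_dim ip (defect_space ip T) n,
      exists m, has_dim ip (defect_space ip Ts) m
    & has_dim ip (ominus ip (defect_space ip Ts) (defect_space ip T)) k].
Proof.
split.
- move=> x /defect_space_head h; apply/defect_space_adj_head.
  by rewrite -h proj_ge // leq_addr.
- exists (fun i : 'I_n => e i); split; first exact: orthonormal_trunc.
  by move=> x; rewrite defect_space_head (proj_span oe).
- exists (n + k)%N, (fun i : 'I_(n + k) => e i); split; first exact: orthonormal_trunc.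
  by move=> x; rewrite defect_space_adj_head (proj_span oe).
have ob : Defs.orthonormal ip (fun i : 'I_k => e (n + i)%N).
  by move=> i j; rewrite oe eqn_add2l.
exists (fun i : 'I_k => e (n + i)%N); split=> // x; rewrite (span_finP ob); split.
  move=> [/defect_space_adj_head h h2].
  have Px : P n x = 0.
    by apply/(proj_eq0 oe) => m mn; apply: h2; apply/defect_space_head; rewrite (proj_basis oe) mn.
  by move: h; rewrite proj_addn Px add0r.
move=> h; have Px : P n x = 0.
  apply/(proj_eq0 oe) => m mn; rewrite -h /fproj ip_suml big1 // => i _.
  rewrite ipZl oe; case: eqP => [E|_]; last by rewrite mulr0.
  by move: mn; rewrite -E ltnNge leq_addr.
split; first by apply/defect_space_adj_head; rewrite proj_addn Px add0r.
by move=> y /defect_space_head <-; rewrite -proj_sym Px ip0l.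
Qed.

End Converse.

Section Direct.
Hypothesis cT : contraction ip T.
Hypothesis kerT : forall x, Ts (T x) = x -> P n x = 0.
Hypothesis kerTs : forall x, T (Ts x) = x -> P (n + k) x = 0.

(** [1 - T'T] maps the span of the first [n] basis vectors to itself, injectively by [kerT]. *)
Lemma sub_adj_comp_surjective y : P n y = y -> exists2 x, P n x = x & x - Ts (T x) = y.
Proof.
move=> /(proj_span oe) hy.
have [|||x /(proj_span oe) hx xy] :=
  finite_dim_surjective (@orthonormal_trunc _ oe n) (A := fun x => x - Ts (T x)) _ _ _ hy.
- exact: (bounded_sub bounded_id (bounded_comp (bounded_adj hT) hT)).1.
- move=> x; apply/(proj_span oe).
  by rewrite (sub_adj_comp he hT T_shift T_head) (lin_opB _ _ (proj_lin e n)) !(proj_idem oe).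
- move=> x /(proj_span oe) <- /eqP; rewrite subr_eq0 eq_sym => /eqP /kerT.
  by rewrite (proj_idem oe).
by exists x.
Qed.

(** Supplies the preimages of basis vectors from which the constant in (3) is built. *)
Lemma sub_comp_adj_surjective y : P (n + k) y = y -> exists x, x - T (Ts x) = y.
Proof.
move=> /(proj_span oe) hy.
have [|||x /(proj_span oe) hx xy] :=
  finite_dim_surjective (@orthonormal_trunc _ oe (n + k)) (A := fun x => x - T (Ts x)) _ _ _ hy.
- exact: (bounded_sub bounded_id (bounded_comp hT (bounded_adj hT))).1.
- move=> x; apply/(proj_span oe).
  by rewrite (sub_comp_adj he hT T_shift T_head) (lin_opB _ _ (proj_lin e _)) (proj_idem oe) T_head.
- move=> x /(proj_span oe) <- /eqP; rewrite subr_eq0 eq_sym => /eqP /kerTs.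
  by rewrite (proj_idem oe).
by exists x.
Qed.

Lemma has_dim_range_sub_adj_comp : has_dim ip (range (fun x => x - Ts (T x))) n.
Proof.
exists (fun i : 'I_n => e i); split; first exact: orthonormal_trunc.
move=> x; rewrite (proj_span oe); split=> [[y ->]|/sub_adj_comp_surjective [y _ <-]]; last by exists y.
by rewrite (sub_adj_comp he hT T_shift T_head) (lin_opB _ _ (proj_lin e n)) !(proj_idem oe).
Qed.

(* With [B] the square root of [1 - T T^*] and [e_i = B^2 w_i], Cauchy-Schwarz
   gives [|<x, e_i>|^2 = |<B x, B w_i>|^2 <= |B x|^2 |B w_i|^2]; the constant is
   the sum of the [|B w_i|^2]. *)
Lemma proj_le_adj_defect : exists lam : R, 0 <= lam /\ forall x,
  nsq (P (n + k) x) <= lam * (nsq x - nsq (Ts x)).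
Proof.
have hTs := bounded_adj hT; have cTs := contraction_adj hT cT.
have [B [hB pB BB]] : exists B, is_pos_sqrt ip (fun x => x - T (Ts x)) B.
  apply: pos_sqrt_exists; first exact: (bounded_comp hT hTs).1.
    by move=> x y; rewrite (adjP _ _ hT) (adjPr _ _ hT).
  by move=> x; apply: le_trans (cT _) (cTs x).
have sB := pos_op_sym hB.1 pB.
have /boolp.choice [w hw] : forall i : 'I_(n + k), exists w, w - T (Ts w) = e i.
  by move=> i; apply: sub_comp_adj_surjective; rewrite (proj_basis oe) ltn_ord.
exists (\sum_i nsq (B (w i))); split; first by apply: sumr_ge0 => i _; apply: nsq_ge0.
move=> x; have <- : nsq (B x) = nsq x - nsq (Ts x).
  by rewrite /nsq sB BB ipBr ReB adjPr.
have -> : nsq (P (n + k) x) =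
    \sum_(i < n + k) (complex.Re (ip x (e i)) ^+ 2 + complex.Im (ip x (e i)) ^+ 2).
  rewrite /nsq (proj_sym e) (proj_idem oe) [ip x _]ipC Re_conjc ip_suml.
  rewrite (big_morph _ (@ReD R) (erefl _)); apply: eq_bigr => i _.
  by rewrite ipZl [ip (e i) x]ipC; case: (ip x (e i)) => a b /=; ring.
rewrite mulr_suml; apply: ler_sum => i _; rewrite -hw -BB -sB mulrC.
exact: cauchy_schwarz.
Qed.

End Direct.

End Model.

(** * The basis adapted to a completely non-unitary contraction *)

Section WoldBasis.
Variables (T : V -> V) (n k : nat) (b : 'I_n -> V) (c : 'I_k -> V).
Hypothesis hk : (0 < k)%N.
Hypothesis hT : bounded_op ip T.
Hypothesis cT : contraction ip T.
Hypothesis cnu : completely_non_unitary ip T.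
Local Notation Ts := (adj ip T).
Hypothesis sub : forall x, defect_space ip T x -> defect_space ip Ts x.
Hypothesis ob : Defs.orthonormal ip b.
Hypothesis hb : forall x, defect_space ip T x <-> span_fin b x.
Hypothesis oc : Defs.orthonormal ip c.
Hypothesis hc : forall x,
  ominus ip (defect_space ip Ts) (defect_space ip T) x <-> span_fin c x.

(** [insub] succeeds exactly for [m < n]. Beyond, the powers of [T] applied to [c] are listed block
    by block, so that [T] raises the index by [k]. *)
Definition wold_basis (m : nat) : V :=
  if insub m is Some i then b i
  else iter ((m - n) %/ k) T (c (Ordinal (ltn_pmod (m - n) hk))).
Local Notation e := wold_basis.

Let e_head (i : 'I_n) : e i = b i.
Proof. by rewrite /e valK. Qed.

Let e_mid (i : 'I_k) : e (n + i)%N = c i.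
Proof.
rewrite /e insubF; last by rewrite ltnNge leq_addr.
have E : (n + i - n = i)%N by rewrite addKn.
rewrite {1}E divn_small //=; congr (c _); apply: val_inj.
by rewrite /= E modn_small.
Qed.

Let e_shift m : (n <= m)%N -> e (m + k)%N = T (e m).
Proof.
move=> nm; rewrite /e !insubF; try by rewrite ltnNge ?nm ?(leq_trans nm) ?leq_addr.
have E : (m + k - n = (m - n) + k)%N by rewrite addnBAC.
rewrite {1}E divnDr // divnn hk addn1 iterS; congr (T (iter _ T (c _))).
by apply: val_inj; rewrite /= E modnDr.
Qed.

Let span_mem N (f : 'I_N -> V) (i : 'I_N) : Defs.orthonormal ip f -> span_fin f (f i).
Proof.
move=> ofam; apply/(span_finP ofam); rewrite /fproj (bigD1 i) //= ofam eqxx scale1r.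
by rewrite big1 ?addr0 // => j ji; rewrite ofam eq_sym (negPf ji) scale0r.
Qed.

Let cTs := contraction_adj hT cT.
Let hTs := bounded_adj hT.

Lemma fixed_TsT_basis x : Ts (T x) = x <-> forall i, ip x (b i) = 0.
Proof.
rewrite (defect_kerP hT cT); split=> [h i|h z /hb [d ->]].
  exact/h/hb/span_mem.
by rewrite ip_sumr big1 // => i _; rewrite ipZr h mulr0.
Qed.

Let c_mem i : ominus ip (defect_space ip Ts) (defect_space ip T) (c i).
Proof. exact/hc/span_mem. Qed.

(** Since the defect space of [T'] contains that of [T], it is the orthogonal sum of the spans of
    [b] and [c]. *)
Lemma fixed_TTs_basis x :
  T (Ts x) = x <-> (forall i, ip x (b i) = 0) /\ (forall i, ip x (c i) = 0).
Proof.
have -> : T (Ts x) = x <-> forall z, defect_space ip Ts z -> ip x z = 0.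
  by rewrite -(defect_kerP hTs cTs) adjK.
split=> [h|[hxb hxc] z hz].
  by split=> i; apply: h; [exact/sub/hb/span_mem | case: (c_mem i)].
have Dp : defect_space ip Ts (fproj b z) by apply/sub/hb/fproj_span.
have [d zE] : span_fin c (z - fproj b z).
  apply/hc; split.
    apply/(defect_spaceP _ hTs cTs) => y hy; rewrite ipBl.
    have /(defect_spaceP _ hTs cTs) -> // := hz.
    by have /(defect_spaceP _ hTs cTs) -> // := Dp; rewrite subrr.
  by move=> y /hb/(span_finP ob) <-; apply: ip_eq0C; exact: fproj_orth.
rewrite -[z](subrK (fproj b z)) zE ipDr !ip_sumr !big1 ?addr0 // => i _.
  by rewrite ipZr hxb mulr0.
by rewrite ipZr hxc mulr0.
Qed.

(** The inclusion of defect spaces read on complements: [L] is contained in [K]. *)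
Let TTs_TsT x : T (Ts x) = x -> Ts (T x) = x.
Proof. by move=> /fixed_TTs_basis [h _]; apply/fixed_TsT_basis. Qed.

Let T_fixed x : Ts (T x) = x -> T (Ts (T x)) = T x.
Proof. by move=> ->. Qed.

Let c_fixed i : Ts (T (c i)) = c i.
Proof.
apply/fixed_TsT_basis => j; case: (c_mem i) => _; apply; exact/hb/span_mem.
Qed.

Let e_cases m : (n <= m)%N ->
  (exists i : 'I_k, m = (n + i)%N) \/ (exists m', [/\ (n <= m')%N, (m' < m)%N & m = (m' + k)%N]).
Proof.
move=> nm; case: (ltnP m (n + k)) => h; [left|right].
  have mk : (m - n < k)%N by rewrite ltn_subLR.
  by exists (Ordinal mk); rewrite /= subnKC.
have km : (k <= m)%N by apply: leq_trans h; exact: leq_addl.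
exists (m - k)%N; rewrite subnK // leq_subRL // addnC h; split=> //.
by rewrite ltn_subrL hk (leq_trans _ km).
Qed.

(** The tail stays in [K]: the first block does by the choice of [c], and [T] maps [K] into [L],
    hence into [K]. *)
Let e_fixed m : (n <= m)%N -> Ts (T (e m)) = e m.
Proof.
elim/ltn_ind: m => m IH nm; case: (e_cases nm) => [[i ->]|[m' [nm' mm ->]]].
  by rewrite e_mid; exact: c_fixed.
by rewrite e_shift //; apply: TTs_TsT; apply: T_fixed; apply: IH.
Qed.

Let isom x y : Ts (T x) = x -> ip (T x) (T y) = ip x y.
Proof. by move=> h; rewrite adjPr // h. Qed.

Let T_perp x i : Ts (T x) = x -> ip (T x) (c i) = 0.
Proof. by move=> /T_fixed/fixed_TTs_basis [_]. Qed.

(** [T] preserves inner products with vectors of [K], which lowers both indices by [k]; once one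
    index reaches the first block, images of [K] lie in [L], which is orthogonal to [c]. *)
Lemma orthonormal_wold_basis : Defs.orthonormal ip e.
Proof.
have head (i : 'I_n) m : (n <= m)%N -> ip (e m) (e i) = 0.
  by move=> nm; rewrite e_head; apply: (fixed_TsT_basis _).1; exact: e_fixed.
have tail m m' : (n <= m)%N -> (n <= m')%N -> ip (e m) (e m') = if m == m' then 1 else 0.
  elim/ltn_ind: m m' => m IH m' nm nm'.
  case: (e_cases nm) => [[i mE]|[p [np pm mE]]]; case: (e_cases nm') => [[i' mE']|[p' [np' pm' mE']]];
    rewrite mE mE' ?e_mid ?e_shift //.
  - by rewrite oc eqn_add2l.
  - rewrite ip_eq0C; last by apply: T_perp; exact: e_fixed.
    case: eqP => // E; have := leq_add np' (leqnn k).
    by rewrite -E leqNgt ltn_add2l ltn_ord.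
  - rewrite T_perp; last exact: e_fixed.
    case: eqP => // E; have := leq_add np (leqnn k).
    by rewrite E leqNgt ltn_add2l ltn_ord.
  - by rewrite isom ?e_fixed // IH // eqn_add2r.
move=> m m'; case: (ltnP m n) => nm; case: (ltnP m' n) => nm'.
- by rewrite (e_head (Ordinal nm)) (e_head (Ordinal nm')) ob.
- rewrite ip_eq0C; last exact: (head (Ordinal nm)).
  by case: eqP => // E; move: nm; rewrite E ltnNge nm'.
- rewrite (head (Ordinal nm')) //.
  by case: eqP => // E; move: nm'; rewrite -E ltnNge nm.
- exact: tail.
Qed.

(* The orthogonal complement of the basis reduces [T] to a unitary operator. *)
Lemma onb_wold_basis : onb ip e.
Proof.
apply: onb_of_total orthonormal_wold_basis _.
pose M := orthocomp (fun y => exists m, y = e m).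
have ME x : M x <-> forall m, ip x (e m) = 0.
  by split=> [h m|h _ [m ->]] //; apply: h; exists m.
have Mb x : M x -> forall i, ip x (b i) = 0 by move=> /ME h i; rewrite -e_head.
have Mc x : M x -> forall i, ip x (c i) = 0 by move=> /ME h i; rewrite -e_mid.
have MTsT x : M x -> Ts (T x) = x by move=> /Mb h; apply/fixed_TsT_basis.
have MTTs x : M x -> T (Ts x) = x.
  by move=> h; apply/fixed_TTs_basis; split; [exact: Mb | exact: Mc].
have MT x : M x -> M (T x).
  move=> Mx; apply/ME => m; have TsTx := MTsT _ Mx.
  have [h1 h2] := (fixed_TTs_basis _).1 (T_fixed TsTx).
  case: (ltnP m n) => nm; first by rewrite (e_head (Ordinal nm)).
  case: (e_cases nm) => [[i ->]|[p [np _ ->]]]; first by rewrite e_mid.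
  by rewrite e_shift // isom //; apply: (ME _).1.
have MTs x : M x -> M (Ts x).
  move=> Mx; apply/ME => m; case: (ltnP m n) => nm.
    rewrite (e_head (Ordinal nm)); apply: (fixed_TsT_basis _).1.
    by rewrite MTTs.
  by rewrite -adjPr // -e_shift //; apply: (ME _).1.
move=> x hx; apply: (cnu (M := M)); last exact/ME.
  by split=> //; exact: closed_orthocomp.
split=> [y /MTsT h|y My].
  by apply/hnorm_eq; apply/contraction_isom.
by exists (Ts y); split; [exact: MTs | exact: MTTs].
Qed.

Lemma exists_wold_basis : exists e : nat -> V,
  [/\ onb ip e, forall m, (n <= m)%N -> T (e m) = e (m + k)%N,
      forall x, proj ip e (n + k) (T (proj ip e n x)) = T (proj ip e n x),
      forall x, Ts (T x) = x -> proj ip e n x = 0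
    & forall x, T (Ts x) = x -> proj ip e (n + k) x = 0].
Proof.
have he := onb_wold_basis; have oe := orthonormal_wold_basis.
exists e; split=> //.
- by move=> m nm; rewrite e_shift.
(* For [m >= n + k] the coefficient is [<T P_n x, T e_(m-k)> = <P_n x, e_(m-k)> = 0], because
   [m - k >= n]. *)
- move=> x; apply: (onb_inj he) => m; rewrite (ip_proj oe); case: ltnP => // nm.
  have nm' : (n <= m - k)%N by rewrite leq_subRL ?(leq_trans (leq_addl n k)) // addnC.
  rewrite -[m](subnK (leq_trans (leq_addl n k) nm)) e_shift //.
  rewrite ip_eq0C // isom ?e_fixed //; apply: ip_eq0C.
  by rewrite (ip_proj oe) ltnNge nm'.
- move=> x /fixed_TsT_basis h; apply/(proj_eq0 oe) => m mn.
  by rewrite (e_head (Ordinal mn)).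
- move=> x /fixed_TTs_basis [h1 h2]; apply/(proj_eq0 oe) => m mnk.
  case: (ltnP m n) => nm; first by rewrite (e_head (Ordinal nm)).
  have mk : (m - n < k)%N by rewrite ltn_subLR.
  by have := e_mid (Ordinal mk); rewrite /= subnKC // => ->.
Qed.

End WoldBasis.

(** * Splitting an operator into a shift and a finite rank part *)

Lemma bounded_rank1 u v : bounded_op ip (fun x => ip x u *: v).
Proof.
split; first by move=> a x y; rewrite ipDl ipZl scalerDl scalerA.
exists (hnorm ip u * hnorm ip v) => x.
rewrite -ler_sqr ?nnegrE ?mulr_ge0 ?hnorm_ge0 // !exprMn !hnorm_sqr nsqZ.
by rewrite mulrAC ler_wpM2r ?nsq_ge0 // mulrC cauchy_schwarz.
Qed.

Lemma bounded_sum N (A : nat -> V -> V) : (forall i, bounded_op ip (A i)) ->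
  bounded_op ip (fun x => \sum_(i < N) A i x).
Proof.
move=> hA; elim: N => [|N IH].
  split; first by move=> a x y; rewrite !big_ord0 scaler0 addr0.
  by exists 0 => x; rewrite big_ord0 hnorm0 mul0r.
have -> : (fun x => \sum_(i < N.+1) A i x) = (fun x => \sum_(i < N) A i x + A N x).
  by apply/boolp.funext => x; rewrite big_ord_recr.
exact: bounded_add.
Qed.

(** Taking [S] equal to [T] on the tail and prescribing it by [G] on the head makes it bounded at
    once, and [T - S] lives on the first [n] coordinates. *)
Lemma shift_plus_finite_rank (T : V -> V) (e : nat -> V) (n k : nat) :
  bounded_op ip T -> Defs.orthonormal ip e ->
  (forall m, (n <= m)%N -> T (e m) = e (m + k)%N) ->
  exists S F : V -> V,
    [/\ bounded_op ip S, forall m, S (e m) = e (m + k)%N, finite_rank F,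
        forall x, T x = S x + F x
      & forall x, F1op ip S F e n (x - proj ip e n x) = 0].
Proof.
move=> hT oe Tsh.
pose G x := \sum_(i < n) ip x (e i) *: e (i + k)%N.
pose S x := T (x - proj ip e n x) + G x.
have hS : bounded_op ip S.
  apply: bounded_add; first exact: bounded_comp hT (bounded_proj_compl oe n).
  by apply: (@bounded_sum n (fun i x => ip x (e i) *: e (i + k)%N)) => i; exact: bounded_rank1.
exists S, (fun x => T x - S x); split=> //.
- move=> m; rewrite /S (proj_compl_basis oe) /G (orthonormal_sum oe (fun i => e (i + k)%N)).
  by case: ltnP => nm; rewrite ?(bounded_op0 hT) ?add0r ?addr0 ?Tsh.
- exists n, (fun i => T (e i) - e (i + k)%N) => x; exists (fun i => ip x (e i)).
  rewrite /S (lin_opB _ _ hT.1) opprD opprB addrA [T x + _]addrC subrK /proj.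
  rewrite (lin_op_sum _ _ _ hT.1) /G -sumrB; apply: eq_bigr => i _.
  by rewrite (lin_opZ _ _ hT.1) scalerBr.
- by move=> x; rewrite addrC subrK.
move=> x; rewrite /F1op (proj_proj_compl oe) (bounded_op0 hS) addr0 /S.
rewrite (proj_proj_compl oe) subr0 /G big1 ?addr0 ?subrr // => i _.
by rewrite ((proj_eq0 oe _ _).1 (proj_proj_compl oe n x)) ?scale0r.
Qed.

End HilbertSpace.

Theorem theorem3p2 (R : realType) (V : lmodType R[i]) (ip : V -> V -> R[i])
  (HV : sep_inf_hilbert ip) (T : V -> V) (HT : bounded_op ip T)
  (n k : nat) (hn : (0 < n)%N) (hk : (0 < k)%N) :
  [/\ contraction ip T /\ completely_non_unitary ip T,
      (forall x, defect_space ip T x -> defect_space ip (adj ip T) x),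
      has_dim ip (defect_space ip T) n,
      (exists m, has_dim ip (defect_space ip (adj ip T)) m)
    & has_dim ip (ominus ip (defect_space ip (adj ip T)) (defect_space ip T)) k]
  <->
  exists (e : nat -> V) (S F : V -> V),
    onb ip e /\
    bounded_op ip S /\ (forall m, S (e m) = e (m + k)%N) /\
    finite_rank F /\
    (forall x, T x = S x + F x) /\
    [/\
        (* (1) rank (P_n - F_1^* F_1) = n *)
        has_dim ip (range (fun x => proj ip e n x
                              - adj ip (F1op ip S F e n) (F1op ip S F e n x))) n,
        (* (2) F_1 (I - P_n) = (I - P_{n+k}) F_1 = 0 *)
        (forall x, F1op ip S F e n (x - proj ip e n x) = 0 /\
                   F1op ip S F e n x - proj ip e (n + k) (F1op ip S F e n x) = 0),
        (* (3) *)
        (exists lam : R, 0 <= lam /\ forall x,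
           lam * hnorm ip (adj ip (F1op ip S F e n) x) ^+ 2
             - hnorm ip (F1op ip S F e n x) ^+ 2
           <= lam * hnorm ip (proj ip e (n + k) x) ^+ 2 - hnorm ip (proj ip e n x) ^+ 2)
      & (* (4) *)
        (forall r, (1 <= r)%N -> forall x,
           hnorm ip (Frop ip S F e n r x) <= hnorm ip (proj ip e n x) /\
           hnorm ip (adj ip (Frop ip S F e n r) x) <= hnorm ip (proj ip e (n + k * r) x)) /\
        (forall x, (forall r, (1 <= r)%N ->
            hnorm ip (Frop ip S F e n r x) = hnorm ip (proj ip e n x) /\
            hnorm ip (adj ip (Frop ip S F e n r) x) = hnorm ip (proj ip e (n + k * r) x))
           -> x = 0)].
Proof.
have [Hip Hc _ _] := HV; split.
  move=> [[cT cnu] sub [b [ob hb]] _ [c [oc hc]]].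
  have [e [he Tsh Thd kT kTs]] := exists_wold_basis Hip Hc hk HT cT cnu sub ob hb oc hc.
  have oe := he.1.
  have [S [F [hS Ssh rF TSF F1Q]]] := shift_plus_finite_rank Hip HT oe Tsh.
  exists e, S, F; do 5!split=> //.
  have adjF1 : adj ip (fun x => T (proj ip e n x)) = fun x => proj ip e n (adj ip T x).
    exact: (adj_iter_proj Hip Hc n he HT 1).
  rewrite (F1opE Hip he hS HT TSF F1Q) adjF1; split.
  - have -> : (fun x => proj ip e n x - proj ip e n (adj ip T (T (proj ip e n x)))) =
              (fun x => x - adj ip T (T x)).
      by apply/boolp.funext => x; rewrite (sub_adj_comp Hip Hc he HT Tsh Thd).
    exact: (has_dim_range_sub_adj_comp Hip Hc he HT Tsh Thd kT).
  - move=> x; rewrite Thd subrr; split=> //.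
    by rewrite (proj_proj_compl Hip oe) (bounded_op0 HT).
  - have [lam [lam0 h]] := proj_le_adj_defect Hip Hc he HT Tsh Thd cT kTs.
    (* With [q = |P_(n+k) x|^2] and [v = |F_1' x|^2], the choice of [lam] reads [q <= lam (q - v)];
       (3) follows from [|P_n x|^2 <= q]. *)
    exists lam; split=> // x; rewrite !(hnorm_sqr Hip).
    have := h x; have := nsq_iter_adj Hip Hc he HT Tsh Thd 1 x; rewrite muln1 /= => ->.
    have := nsq_proj_le Hip oe x (leq_addr k n).
    have := nsq_ge0 Hip (T (proj ip e n x)).
    set u := nsq _ _; set p := nsq _ (proj _ _ n x); set q := nsq _ (proj _ _ (n + k) x).
    set v := nsq _ (proj _ _ n _); set w := nsq _ x.
    have -> : lam * (w - (v + w - q)) = lam * q - lam * v by ring.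
    lra.
  - have [h1 h2] := (contraction_iff_head Hip Hc he HT Tsh Thd, cnu_iff Hip Hc HT cT).
    split=> [r r1|x hx]; first by rewrite (FropE Hip Hc he hS HT Ssh TSF F1Q r1); exact: h1.2.
    apply: h2.1 => //; apply/(iter_isometric_iff_head Hip Hc he HT Tsh Thd) => r r1.
    by have := hx r r1; rewrite (FropE Hip Hc he hS HT Ssh TSF F1Q r1).
move=> [e [S [F [he [hS [Ssh [_ [TSF [rk F1 _ [Fle Feq]]]]]]]]]].
(* The two halves of (2) yield that [T] shifts the tail and that [T P_n] stays within the first
   [n + k] coordinates. *)
have F1Q x : F1op ip S F e n (x - proj ip e n x) = 0 by case: (F1 x).
have Tsh := T_shift_of_F1op Hip he hS Ssh TSF F1Q.
have F1E := F1opE Hip he hS HT TSF F1Q.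
have Thd x : proj ip e (n + k) (T (proj ip e n x)) = T (proj ip e n x).
  by case: (F1 x) => _ /eqP; rewrite F1E subr_eq0 => /eqP.
have FE r (r1 : (1 <= r)%N) := FropE Hip Hc he hS HT Ssh TSF F1Q r1.
have cT : contraction ip T.
  by apply/(contraction_iff_head Hip Hc he HT Tsh Thd) => r r1; have := Fle r r1; rewrite FE.
have adjF1 : adj ip (fun x => T (proj ip e n x)) = fun x => proj ip e n (adj ip T x).
  exact: (adj_iter_proj Hip Hc n he HT 1).
have {}rk : has_dim ip (range (fun x => x - adj ip T (T x))) n.
  have -> : (fun x => x - adj ip T (T x)) =
      (fun x => proj ip e n x - proj ip e n (adj ip T (T (proj ip e n x)))).
    by apply/boolp.funext => x; rewrite (sub_adj_comp Hip Hc he HT Tsh Thd).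
  by move: rk; rewrite F1E adjF1.
have [h1 h2 h3 h4] := defect_dims Hip Hc he HT Tsh Thd cT rk; split=> //; split=> //.
apply/(cnu_iff Hip Hc HT cT) => x /(iter_isometric_iff_head Hip Hc he HT Tsh Thd) h.
by apply: Feq => r r1; rewrite FE //; apply: h.
Qed.
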